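(* The map $\Psi:\mathcal{Y}(0)\to P_{\Lambda_0}$ is a bijection and an isomorphism of crystals: it preserves weights, and for every $b\in\mathcal{Y}(0)$ and $i\in\{0,1\}$ one has $\Psi(f_i b)=f_i\Psi(b)$ and $\Psi(e_i b)=e_i\Psi(b)$ (with the convention $\Psi(0)=0$; in particular $f_ib\neq 0$ if and only if $f_i\Psi(b)\neq 0$, and likewise for $e_i$). Here $e_i,f_i$ on the left are the root operators on charged partitions and on the right Littelmann's root operators on LS paths.
   Context: Let $\widehat{\mathfrak{sl}_2}$ be the affine Kac–Moody algebra with simple roots $\alpha_0,\alpha_1$, simple coroots $\alpha_0^\vee,\alpha_1^\vee$, fundamental weights $\Lambda_0,\Lambda_1$, null root $\delta=\alpha_0+\alpha_1$, and Weyl group $W$ generated by the simple reflections $s_0,s_1$. Write $s_j:=s_0$ if $j$ is even and $s_j:=s_1$ if $j$ is odd. For $k\ge 0$ put $w_k=w_k^+:=s_{k-1}\cdots s_1s_0$ (the alternating product of $k$ simple reflections ending on the right with $s_0$; $w_0=1$). The elements $w_k$, $k\ge0$, are the minimal coset representatives of $W/W_{\Lambda_0}$ ($W_{\Lambda_0}$ the stabilizer of $\Lambda_0$), and $w_m>w_n$ in Bruhat order iff $m>n$. Charged partitions. Let $I=\{0,1\}$. A charged partition is a pair $(\pi,j)$ with $\pi$ an integer partition (possibly empty) and $j\in I$ its charge. Its diagram is the Young diagram of $\pi$ (rows numbered from the top, columns from the left) in which the box in row $r$, column $c$ is labelled $j-r+c \pmod 2$. Its weight is $\Lambda_j-n_0\alpha_0-n_1\alpha_1$,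 where $n_i$ is the number of boxes labelled $i$. It is ($2$-)regular if the nonzero parts of $\pi$ are distinct. $\mathcal{Y}(j)$ denotes the set of regular charged partitions of charge $j$. A column is $i$-removable if its bottom box is labelled $i$ and removing it leaves a Young diagram; it is $i$-addable if a box labelled $i$ can be added at its bottom leaving a Young diagram. The $i$-signature is the string of signs obtained by scanning the columns from left to right, including the first empty column (column $\pi_1+1$), writing $+$ for an $i$-addable column, $-$ for an $i$-removable column and nothing otherwise; each sign is remembered together with the column contributing it. A (possibly empty) string of signs is reducible if it has equally many $-$ and $+$ signs and every initial segment has at least as many $-$ as $+$ signs; a substring is a contiguous piece of a string. The reduction of a string is what remains after deleting all signs lying in some reducible substring (it has the form $+\cdots+-\cdots-$). The reduced $i$-signature is the reduction of the $i$-signature. The root operator $e_i$ (resp. $f_i$) removes the bottom box of the column contributing the leftmost $-$ (resp. adds a box labelled $i$ at the bottom of the column contributing the rightmost $+$) of the reduced $i$-signature; if there is no such sign the result is the null element $0$. $\varepsilon_i$ (resp. $\varphi_i$) is the number of $-$ (resp. $+$) signs in the reduced $i$-signature. LS paths. $P_{\Lambda_0}$ is the set of Lakshmibai–Seshadri paths of shape $\Lambda_0$ with Littelmann's crystal structure (root operators $e_i,f_i$, weight = endpoint). A path $(\sigma_1>\dots>\sigma_r;\,0=a_0<a_1<\dots<a_r=1)$ is the piecewise linear map $t\mapsto\sum_{k<j}(a_k-a_{k-1})\sigma_k\Lambda_0+(t-a_{j-1})\sigma_j\Lambda_0$ for $t\in[a_{j-1},a_j]$. The map $\Psi$. For $b=(\mu_1>\mu_2>\dots>\mu_l>0)\in\mathcal{Y}(0)$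 set $m=\mu_1$, $n=l$ (so $m\ge n$), let $\tilde b=(\mu_1-n,\mu_2-(n-1),\dots,\mu_l-1)$, and let its conjugate partition be $(i_{n+1}\ge i_{n+2}\ge\dots\ge i_m)$ (exactly $m-n$ positive parts). Define $\Psi(b)=(w_m>w_{m-1}>\dots>w_{n+1}>w_n;\ 0<\tfrac{i_m}{m}<\tfrac{i_{m-1}}{m-1}<\dots<\tfrac{i_{n+1}}{n+1}<1)$; for $b$ empty, $\Psi(b)=(1;0<1)$. *)

(* Defs.v *)
From HB Require Import structures.
From mathcomp Require Import all_boot all_order all_algebra.
From mathcomp Require Import reals.
Set Implicit Arguments. Unset Strict Implicit. Unset Printing Implicit Defensive.
Import Order.TTheory GRing.Theory Num.Theory.
Local Open Scope ring_scope.

(* Weights of affine sl_2.  h^* has basis (Lambda_0, alpha_0, alpha_1);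
   a weight  c Lambda_0 + x alpha_0 + y alpha_1  is the row vector (c,x,y). *)
Section Weights.
Variable F : fieldType.
Definition wt := 'rV[F]_3.
Definition mkw (c x y : F) : wt :=
  \row_(k < 3) (if (k : nat) == 0%N then c else if (k : nat) == 1%N then x else y).
Definition Lam0 : wt := mkw 1 0 0.
Definition alpha0 : wt := mkw 0 1 0.
Definition alpha1 : wt := mkw 0 0 1.
Definition delta : wt := alpha0 + alpha1.
Definition alpha (i : nat) : wt := if odd i then alpha1 else alpha0.
(* Lambda_1 = Lambda_0 + alpha_1 / 2  (since alpha_1 = 2 Lambda_1 - 2 Lambda_0) *)
Definition Lam (j : nat) : wt := if odd j then Lam0 + 2^-1 *: alpha1 else Lam0.
Definition wcoord (v : wt) (k : nat) : F := v ord0 (inord k).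
(* pairing <v, alpha_i^vee>, Cartan matrix [[2,-2],[-2,2]], <Lambda_0,alpha_0^vee>=1,
   <Lambda_0,alpha_1^vee>=0 *)
Definition pairc (v : wt) (i : nat) : F :=
  if odd i then - 2 * wcoord v 1 + 2 * wcoord v 2
  else wcoord v 0 + 2 * wcoord v 1 - 2 * wcoord v 2.
Definition sref (i : nat) (v : wt) : wt := v - pairc v i *: alpha i.
(* w_k Lambda_0 where w_k = s_{k-1} ... s_1 s_0 ;  w_{k+1} = s_k w_k *)
Fixpoint wLam (k : nat) : wt :=
  if k is k'.+1 then sref k' (wLam k') else Lam0.
(* positive real roots of affine sl_2 : (true, n) ~ alpha_1 + n delta (n >= 0),
   (false, n) ~ - alpha_1 + n delta (n >= 1) *)
Definition posroot (b : bool * nat) : bool := b.1 || (0 < b.2)%N.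
Definition rootv (b : bool * nat) : wt :=
  (if b.1 then alpha1 else - alpha1) + b.2%:R *: delta.
(* pairing with the coroot beta^vee = +-alpha_1^vee + n K, K = alpha_0^vee + alpha_1^vee *)
Definition pairr (v : wt) (b : bool * nat) : F :=
  (if b.1 then pairc v 1 else - pairc v 1) + b.2%:R * (pairc v 0 + pairc v 1).
Definition rref (b : bool * nat) (v : wt) : wt := v - pairr v b *: rootv b.
End Weights.

(* An LS path (w_{m_1} > ... > w_{m_r} ; 0 = a_0 < a_1 < ... < a_r = 1)  *)
(* is encoded by lsig = [:: m_1; ...; m_r] and lbr = [:: a_1; ...; a_{r-1}]. *)
Record LSdata := LSD { lsig : seq nat; lbr : seq rat }.

(* a-chain for (w_p, w_q), p > q: since W/W_{Lambda_0} = {w_k} is totally ordered by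
   Bruhat order with l(w_k) = k, the only chain of covers is w_p > w_{p-1} > ... > w_q;
   the condition asks, for each step w_k = s_beta w_{k-1} (beta positive real root),
   that a <w_{k-1} Lambda_0, beta^vee> be an integer. *)
Definition achain (a : rat) (p q : nat) : Prop :=
  forall k : nat, (q < k <= p)%N ->
    exists beta : bool * nat,
      [/\ posroot beta,
          rref beta (wLam rat k.-1) = wLam rat k
        & a * pairr (wLam rat k.-1) beta \is a Num.int].

Definition is_LS (d : LSdata) : Prop :=
  let s := lsig d in let a := lbr d in
  [/\ (0 < size s)%N,
      sorted (fun x y => y < x)%N s,
      size a = (size s).-1,
      sorted (fun x y => x < y) (0 :: a ++ [:: 1]) &
      forall j : nat, (j < (size s).-1)%N ->
        achain (nth 0 a j) (nth 0%N s j) (nth 0%N s j.+1)].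

(* the piecewise linear path t |-> sum_{k<j}(a_k - a_{k-1}) sigma_k Lambda_0
   + (t - a_{j-1}) sigma_j Lambda_0  on [a_{j-1}, a_j] *)
Definition lspath (R : realType) (d : LSdata) (t : R) : wt R :=
  let A := [seq ratr x : R | x <- 0 :: lbr d ++ [:: 1]] in
  \sum_(j < size (lsig d))
    (Num.min (Num.max t (nth 0 A j)) (nth 0 A j.+1) - nth 0 A j)
      *: wLam R (nth 0%N (lsig d) j).

(* Littelmann's root operators on paths pi : [0,1] -> h^*_R, pi(0) = 0 *)
(* (None stands for the null element 0).                               *)
Section RootOps.
Variable R : realType.
Definition IsMinIn (S : R -> Prop) (x : R) := S x /\ forall y, S y -> x <= y.
Definition IsMaxIn (S : R -> Prop) (x : R) := S x /\ forall y, S y -> y <= x.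

Definition Lf (i : nat) (pi : R -> wt R) (res : option (R -> wt R)) : Prop :=
  let h t := pairc (pi t) i in
  exists Q : R,
    IsMinIn (fun v => exists t, 0 <= t <= 1 /\ h t = v) Q /\
    ((h 1 - Q < 1 /\ res = None) \/
     (1 <= h 1 - Q /\
      exists t0 t1 : R,
        [/\ IsMaxIn (fun t => 0 <= t <= 1 /\ h t = Q) t0,
            IsMinIn (fun t => t0 <= t <= 1 /\ h t = Q + 1) t1 &
            exists pi' : R -> wt R, res = Some pi' /\
              forall t, 0 <= t <= 1 ->
                pi' t = (if t <= t0 then pi t
                         else if t <= t1 then pi t0 + sref i (pi t - pi t0)
                         else pi t - alpha R i)])).

Definition Le (i : nat) (pi : R -> wt R) (res : option (R -> wt R)) : Prop :=
  let h t := pairc (pi t) i in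
  exists Q : R,
    IsMinIn (fun v => exists t, 0 <= t <= 1 /\ h t = v) Q /\
    ((-1 < Q /\ res = None) \/
     (Q <= -1 /\
      exists t0 t1 : R,
        [/\ IsMinIn (fun t => 0 <= t <= 1 /\ h t = Q) t1,
            IsMaxIn (fun t => 0 <= t <= t1 /\ h t = Q + 1) t0 &
            exists pi' : R -> wt R, res = Some pi' /\
              forall t, 0 <= t <= 1 ->
                pi' t = (if t <= t0 then pi t
                         else if t <= t1 then pi t0 + sref i (pi t - pi t0)
                         else pi t + alpha R i)])).
End RootOps.

(* Charged partitions.  A partition is the seq of its nonzero parts     *)
(* (nonincreasing).  Rows r and columns c are numbered from 1; the box   *)
(* (r,c) of charge j has label (j - r + c) mod 2 = (j + r + c) mod 2.   *)
Definition is_partition (p : seq nat) : bool :=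
  sorted geq p && all (fun x => 0 < x)%N p.
Definition is_regular (p : seq nat) : bool :=
  sorted (fun x y => y < x)%N p && all (fun x => 0 < x)%N p.
Definition inY0 (p : seq nat) : bool := is_regular p.

Definition label (j r c : nat) : nat := ((j + r + c) %% 2)%N.
Definition colh (p : seq nat) (c : nat) : nat := count (fun x => c <= x)%N p.

Definition removable (j i : nat) (p : seq nat) (c : nat) : bool :=
  [&& (0 < colh p c)%N, (colh p c.+1 < colh p c)%N & label j (colh p c) c == i].
Definition addable (j i : nat) (p : seq nat) (c : nat) : bool :=
  ((c == 1%N) || (colh p c < colh p c.-1)%N) && (label j (colh p c).+1 c == i).

(* i-signature: columns 1 .. p_1 + 1; true = '+', false = '-' ; paired with column *)
Definition signature (j i : nat) (p : seq nat) : seq (bool * nat) :=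
  flatten [seq (if addable j i p c then [:: (true, c)]
                else if removable j i p c then [:: (false, c)] else [::])
          | c <- iota 1 (head 0%N p).+1].

Definition reducible (s : seq bool) : bool :=
  (count negb s == count id s) &&
  all (fun k => count id (take k s) <= count negb (take k s))%N (iota 0 (size s).+1).
Definition deleted (s : seq bool) (k : nat) : bool :=
  has (fun l => has (fun r => (l <= k < r)%N && reducible (take (r - l) (drop l s)))
                    (iota 0 (size s).+1))
      (iota 0 (size s).+1).
Definition reduction (s : seq (bool * nat)) : seq (bool * nat) :=
  mask [seq ~~ deleted (map fst s) k | k <- iota 0 (size s)] s.

Definition remove_box (p : seq nat) (c : nat) : seq nat :=
  let r := colh p c in
  [seq x <- set_nth 0%N p r.-1 (nth 0%N p r.-1).-1 | (0 < x)%N].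
Definition add_box (p : seq nat) (c : nat) : seq nat :=
  let r := (colh p c).+1 in set_nth 0%N p r.-1 (nth 0%N p r.-1).+1.

(* root operators on charged partitions of charge j; None = null element *)
Definition cf (j i : nat) (p : seq nat) : option (seq nat) :=
  let s := [seq x <- reduction (signature j i p) | x.1] in
  if s is [::] then None else Some (add_box p (last (true, 0%N) s).2).
Definition ce (j i : nat) (p : seq nat) : option (seq nat) :=
  let s := [seq x <- reduction (signature j i p) | ~~ x.1] in
  if s is x :: _ then Some (remove_box p x.2) else None.

Definition nboxes (j i : nat) (p : seq nat) : nat :=
  \sum_(r < size p) \sum_(1 <= c < (nth 0%N p r).+1) (label j r.+1 c == i).
Definition pwt (F : fieldType) (j : nat) (p : seq nat) : wt F :=
  Lam F j - (nboxes j 0 p)%:R *: alpha0 F - (nboxes j 1 p)%:R *: alpha1 F.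

Definition Psi (b : seq nat) : LSdata :=
  let m := head 0%N b in
  let n := size b in
  let bt := [seq (nth 0 b k - (n - k))%N | k <- iota 0 n] in
  let i_ (k : nat) := count (fun x => k - n <= x)%N bt in   (* conjugate of tilde b *)
  LSD (rev (iota n (m - n).+1))
      [seq ((i_ k)%:R / k%:R : rat) | k <- rev (iota n.+1 (m - n))].

Arguments lspath R d t : clear implicits.
Arguments pwt F j p : clear implicits.
Arguments wLam F k : clear implicits.

(* Main.v *)
Require Import Defs.
From HB Require Import structures.
From mathcomp Require Import all_boot all_order all_algebra.
From mathcomp Require Import reals zify ring lra.
Set Implicit Arguments. Unset Strict Implicit. Unset Printing Implicit Defensive.
Import Order.TTheory GRing.Theory Num.Theory.
Local Open Scope ring_scope.

(** In a regular partition the boxes of each antidiagonal are top-justified, so b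
    is determined by the numbers i_k of boxes on its antidiagonals, and all boxes
    of the k-th antidiagonal carry the label k - 1 mod 2.  Summation by parts
    gives, for t in [0, 1],
      Psi(b)(t) = t Lambda_0 - sum_(k >= 1) min(k t, i_k) alpha_(k-1),
    which yields the weight at t = 1 and shows that adding a box of row r
    (counted from 0) to the k-th antidiagonal subtracts from the path the multiple
    of alpha_(k-1) growing from 0 to 1 on [r/k, (r+1)/k].
    Every row contributes one sign to the i-signature, determined by the parity of
    the antidiagonal on which the row ends.  With D(r) the sum of the signs of the
    first r rows, the function t |-> <Psi(b)(t), alpha_i^vee> takes the value
    D(i_k) at its possible local minima i_k/k, k <> i mod 2.  Hence its last
    (first) absolute minimum corresponds to the last (first) minimum of D, which
    is where bracket cancellation locates the box moved by f_i (e_i). *)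

(** * Antidiagonals of a regular partition *)

(** A downward closed predicate holds on an initial segment whose length is the count. This turns
    the counts behind antidiagonal lengths and column heights into thresholds. *)
Lemma count_iota_down (P : pred nat) k r :
    (forall r r', r <= r' < k -> P r' -> P r)%N -> (r < k)%N ->
  (r < count P (iota 0 k))%N = P r.
Proof.
elim: k => // k IHk Pdown; rewrite ltnS => le_rk.
rewrite -[in iota _ _](addn1 k) iotaD add0n count_cat /= addn0.
have cle : (count P (iota 0 k) <= k)%N.
  by rewrite -{2}(size_iota 0 k) count_size.
have [Pk|Pk] := boolP (P k).
  have Pall s : (s <= k)%N -> P s by move=> sk; apply: Pdown Pk; rewrite sk /=.
  rewrite (Pall _ le_rk) (_ : count P _ = k); first by lia.
  rewrite -{2}(size_iota 0 k); apply/eqP; rewrite -all_count; apply/allP => s.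
  by rewrite mem_iota add0n => /andP[_ /ltnW/Pall].
rewrite addn0; move: le_rk; rewrite leq_eqVlt => /predU1P[->|lt_rk].
  by rewrite (negPf Pk); lia.
apply: IHk => // s s' /andP[ss' s'k]; apply: Pdown; lia.
Qed.

Lemma regular_gt b r : inY0 b -> (r < size b)%N ->
  (nth 0%N b r.+1 < nth 0%N b r)%N.
Proof.
move=> /andP[srt pos] ltrn; have [ltr1n|ler1n] := ltnP r.+1 (size b).
  by move/(sortedP 0%N): srt; apply.
by rewrite nth_default //; have /allP := pos; apply; rewrite mem_nth.
Qed.

(* Boxes are indexed from row 0 and column 1, so that box (r, c) lies on the
   antidiagonal r + c; its label has the parity of r + c - 1. *)
Definition diag_end (b : seq nat) (r : nat) : nat := (nth 0%N b r + r)%N.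
Definition diag_len (b : seq nat) (k : nat) : nat :=
  count (fun r => k <= diag_end b r)%N (iota 0 k).

Section Antidiagonals.
Variable b : seq nat.
Hypothesis reg_b : inY0 b.
Local Notation n := (size b).
Local Notation m := (head 0%N b).
Local Notation q := (diag_end b).
Local Notation len := (diag_len b).

Lemma diag_end_ge r : (r <= q r)%N.
Proof. exact: leq_addl. Qed.

Lemma diag_end_out r : (n <= r)%N -> q r = r.
Proof. by move=> nr; rewrite /diag_end nth_default. Qed.

(** Going down one row loses at least one box, the parts being distinct, and gains one antidiagonal.
    The bound by [n] matters: past it [diag_end] increases. *)
Lemma diag_end_anti r s : (r <= s <= n)%N -> (q s <= q r)%N.
Proof.
case/andP; elim: s => [|s IHs]; first by rewrite leqn0 => /eqP->.
rewrite leq_eqVlt => /predU1P[-> //|]; rewrite ltnS => rs sn.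
apply: leq_trans (IHs rs (ltnW sn)).
by have := regular_gt reg_b sn; rewrite /diag_end; lia.
Qed.

Lemma diag_end_size r : (r <= n)%N -> (n <= q r)%N.
Proof.
by move=> rn; rewrite -{1}(diag_end_out (leqnn n)) diag_end_anti // rn /=.
Qed.

(** Top-justification: a row above one that meets the antidiagonal meets it too, while an empty row
    [s < k] has [diag_end] equal to [s] and is never counted. *)
Lemma diag_lenP r k : (r < k)%N -> (r < len k)%N = (k <= q r)%N.
Proof.
move=> rk; rewrite /diag_len count_iota_down // => s s' /andP[ss' s'k] kq.
have [ns'|s'n] := leqP n s'; first by move: kq; rewrite diag_end_out //; lia.
by apply: leq_trans kq _; apply: diag_end_anti; rewrite ss' ltnW.
Qed.

Lemma diag_len_leq k : (len k <= k)%N.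
Proof. by rewrite -{2}(size_iota 0 k) count_size. Qed.

Lemma diag_len_full k : (k <= n)%N -> len k = k.
Proof.
case: k => // k kn; apply/eqP; rewrite eqn_leq diag_len_leq diag_lenP //=.
by apply: leq_trans (diag_end_size _) => //; apply: ltnW.
Qed.

Lemma diag_len_size k : (n <= k)%N -> (len k <= n)%N.
Proof.
rewrite leq_eqVlt => /predU1P[<-|nk]; first by rewrite diag_len_full.
by rewrite leqNgt diag_lenP // diag_end_out // -ltnNge.
Qed.

Lemma diag_len_mono k : (n <= k)%N -> (len k.+1 <= len k)%N.
Proof.
move=> nk; rewrite leqNgt diag_lenP; last by rewrite ltnS diag_len_leq.
have := diag_len_leq k; rewrite leq_eqVlt => /predU1P[->|lk].
  by rewrite diag_end_out // ltnn.
have := diag_lenP lk; rewrite ltnn => /esym/negbT; rewrite -!ltnNge => h.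
exact: ltnW.
Qed.

Lemma diag_len0 k : (m < k)%N -> len k = 0%N.
Proof.
move=> mk; apply/eqP; rewrite -leqn0 leqNgt diag_lenP; last by lia.
by rewrite /diag_end nth0 addn0 -ltnNge.
Qed.

Lemma size_le_head : (n <= m)%N.
Proof. by have := diag_end_size (leq0n n); rewrite /diag_end nth0 addn0. Qed.

(** A row counted on antidiagonal [k] but not on the next one ends there. The rows are thus cut into
    blocks of constant sign. *)
Lemma diag_end_block k r : (n <= k)%N -> (len k.+1 <= r < len k)%N -> q r = k.
Proof.
move=> nk /andP[r1 r2]; have rk := leq_trans r2 (diag_len_leq k).
have := diag_lenP rk; rewrite r2 => /esym kq.
have := diag_lenP (ltnW rk : (r < k.+1)%N); rewrite ltnNge r1 /= => /esym.
by move/negbT; rewrite -ltnNge; lia.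
Qed.

End Antidiagonals.

(* The height function of the i-signature, read from the top row downwards. *)
Definition sgn_sum (i : nat) (b : seq nat) (r : nat) : int :=
  \sum_(0 <= s < r) (-1) ^+ (diag_end b s + i).

(* The empty row below the diagram contributes a sign (+) only if its first box
   has label i. *)
Definition nsigns (i : nat) (b : seq nat) : nat :=
  (size b + ~~ odd (size b + i))%N.

Lemma nsigns_le i b : (nsigns i b <= (size b).+1)%N.
Proof. by rewrite /nsigns; case: odd => /=; lia. Qed.

Section SignSum.
Variables (i : nat) (b : seq nat).
Hypothesis reg_b : inY0 b.
Local Notation n := (size b).
Local Notation m := (head 0%N b).
Local Notation q := (diag_end b).
Local Notation len := (diag_len b).
Local Notation D := (sgn_sum i b).

Lemma sgn_sumS r : D r.+1 = D r + (-1) ^+ (q r + i).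
Proof. by rewrite /sgn_sum big_nat_recr. Qed.

Lemma sgn_sum_const k r s : (r <= s)%N -> (forall x, (r <= x < s)%N -> q x = k) ->
  D s = D r + (-1) ^+ (k + i) * (s%:Z - r%:Z).
Proof.
move=> rs qk; rewrite /sgn_sum (big_cat_nat (leq0n r) rs) /=; congr (_ + _).
rewrite (eq_big_nat _ _ (F2 := fun=> (-1) ^+ (k + i))); last first.
  by move=> x xrs; rewrite qk.
by rewrite sumr_const_nat -mulr_natr subzn // natz.
Qed.

Lemma sgn_sum_block k : (n <= k)%N ->
  D (len k) = D (len k.+1) + (-1) ^+ (k + i) * ((len k)%:Z - (len k.+1)%:Z).
Proof.
move=> nk; apply: sgn_sum_const => [|x]; first exact: diag_len_mono.
exact: diag_end_block.
Qed.

(** Downward induction from [M], where both sides vanish. The sum is the contribution of completed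
    antidiagonals to the pairing with the coroot. *)
Lemma sgn_sum_diag k M : (m < M)%N -> (n <= k <= M)%N ->
  2 * \sum_(k <= j < M) (-1) ^+ (j + i) * (len j)%:Z
    = D (len k) + (-1) ^+ (k + i) * (len k)%:Z.
Proof.
move=> mM /andP[nk kM]; have [d Hd] := ubnP (M - k).
elim: d => // d IHd in k nk kM Hd *.
move: kM; rewrite leq_eqVlt => /predU1P[->|kM].
  by rewrite big_geq // diag_len0 // /sgn_sum big_geq // !mulr0.
rewrite big_ltn // mulrDr IHd; [|by lia|by lia|by lia].
by rewrite (sgn_sum_block nk) addSn exprS; ring.
Qed.

Lemma sgn_sum_last : D (nsigns i b) =
  if odd (n + i) then D n else D (len n.+1) + (n.+1%:Z - (len n.+1)%:Z).
Proof.
rewrite /nsigns; case: ifPn => o /=; first by rewrite addn0.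
have ln := diag_len_size reg_b (leqnSn n).
(* Rows [len n.+1] to [n], the empty row included, all end on antidiagonal [n]. *)
rewrite addn1 (@sgn_sum_const n (len n.+1) n.+1); first last.
- move=> x /andP[x1]; rewrite ltnS leq_eqVlt => /predU1P[->|xn].
    exact: diag_end_out.
  by apply: diag_end_block => //; rewrite x1 diag_len_full.
- exact: leqW.
by rewrite -signr_odd (negPf o) expr0 mul1r.
Qed.

End SignSum.

(** * Reduction of sign words *)

Definition height (w : seq bool) (x : nat) : int :=
  (count id (take x w))%:Z - (count negb (take x w))%:Z.

Section SignWords.
Variable w : seq bool.

Lemma heightS x : (x < size w)%N ->
  height w x.+1 = height w x + (if nth false w x then 1 else -1).
Proof.
move=> xw; rewrite /height (take_nth false xw) -cats1 !count_cat /=.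
by case: nth => /=; lia.
Qed.

(** With [+] as a step up, a reducible substring returns to its starting height without ever rising
    above it. *)
Lemma deletedP k :
  reflect (exists l r, [/\ (l <= k < r)%N, (r <= size w)%N,
             height w r = height w l &
             forall x, (l <= x <= r)%N -> height w x <= height w l])
          (deleted w k).
Proof.
have countE (a : pred bool) l x :
    count a (take x (drop l w)) = (count a (take (l + x) w) - count a (take l w))%N.
  by rewrite takeD count_cat addKn.
have countM (a : pred bool) l x : (count a (take l w) <= count a (take (l + x) w))%N.
  by rewrite takeD count_cat leq_addr.
apply: (iffP hasP) => [[l _ /hasP[r]]|[l [r [lkr rw hr hx]]]].
  rewrite mem_iota add0n ltnS => rw /andP[lkr /andP[/eqP E /allP A]].
  exists l, r; split=> //.
    move: E; rewrite !countE subnKC; last by lia.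
    have /= := countM id l (r - l)%N; have /= := countM negb l (r - l)%N.
    by rewrite subnKC /height; lia.
  move=> x lxr; have /A : (x - l \in iota 0 (size (take (r - l) (drop l w))).+1)%N.
    by rewrite mem_iota size_takel ?size_drop; lia.
  rewrite take_takel; last by lia.
  rewrite !countE subnKC; last by lia.
  have /= := countM id l (x - l)%N; have /= := countM negb l (x - l)%N.
  by rewrite subnKC /height; lia.
exists l; first by rewrite mem_iota; lia.
apply/hasP; exists r; first by rewrite mem_iota; lia.
rewrite lkr /=; apply/andP; split.
  rewrite !countE subnKC; last by lia.
  have /= := countM id l (r - l)%N; have /= := countM negb l (r - l)%N.
  by move: hr; rewrite subnKC /height; lia.
apply/allP => x; rewrite mem_iota size_takel ?size_drop; last by lia.
move=> xr; rewrite take_takel; last by lia.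
rewrite !countE.
have /= := countM id l x; have /= := countM negb l x.
by have := hx (l + x)%N; rewrite /height; lia.
Qed.

(** The cancelling substring starts at the last position [l <= p] at least as high as [p.+1].
    Heights in between are lower and change by one, so both ends have the same height. *)
Lemma first_max_plus_deleted j p : (j <= p < size w)%N ->
    (forall x, (x <= size w)%N -> height w x <= height w j) ->
  nth false w p -> deleted w p.
Proof.
move=> /andP[jp pw] jmax wp; apply/deletedP.
have hp := heightS pw; rewrite wp in hp.
pose P x := (x <= p)%N && (height w p.+1 <= height w x).
have exP : exists x, P x by exists j; rewrite /P jp jmax.
have ubP x : P x -> (x <= p)%N by case/andP.
case: (ex_maxnP exP ubP) => l /andP[lp hl] lmax.
have above x : (l < x <= p)%N -> height w x < height w p.+1.
  move=> /andP[lx xp]; rewrite ltNge; apply/negP => hx.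
  by have := lmax x; rewrite /P xp hx => /(_ isT); rewrite leqNgt lx.
have lltp : (l < p)%N.
  by rewrite ltn_neqAle lp andbT; apply/eqP => El; move: hl; rewrite El; lia.
have hle : height w l = height w p.+1.
  have := above l.+1; rewrite ltnSn lltp => /(_ isT).
  have lw : (l < size w)%N by lia.
  by rewrite (heightS lw); case: nth; lia.
exists l, p.+1; split=> //; first by lia.
move=> x /andP[lx xp]; rewrite hle.
case: (ltngtP l x) lx => // [lx _|<- _]; last by rewrite hle.
move: xp; rewrite leq_eqVlt => /predU1P[-> //|]; rewrite ltnS => xp.
by rewrite ltW // above // lx.
Qed.

Lemma first_max_plus p : (p < size w)%N ->
    (forall x, (x <= p)%N -> height w x < height w p.+1) ->
  nth false w p /\ ~~ deleted w p.
Proof.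
move=> pw pmax; split.
  by have := pmax p (leqnn p); rewrite heightS //; case: nth => //; lia.
apply/deletedP => -[l [r [/andP[lp pr] _ _ hx]]].
have := hx p.+1; have := pmax l lp; lia.
Qed.

(** Mirror argument: the substring runs from the [-] to the first later position at least as high as
    its start. *)
Lemma last_max_minus_deleted j p : (p < j <= size w)%N ->
    (forall x, (x <= size w)%N -> height w x <= height w j) ->
  ~~ nth false w p -> deleted w p.
Proof.
move=> /andP[pj jw] jmax wp; apply/deletedP.
have pw : (p < size w)%N by lia.
have hp := heightS pw; rewrite (negPf wp) in hp.
pose P x := (p < x <= j)%N && (height w p <= height w x).
have exP : exists x, P x.
  by exists j; rewrite /P pj leqnn jmax // ltnW.
case: (ex_minnP exP) => r /andP[/andP[pr rj] hr] rmin.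
have below x : (p < x < r)%N -> height w x < height w p.
  move=> /andP[px xr]; rewrite ltNge; apply/negP => hx.
  have := rmin x; rewrite /P px hx (leq_trans (ltnW xr) rj) => /(_ isT).
  by rewrite leqNgt xr.
have p1r : (p.+1 < r)%N.
  by rewrite ltn_neqAle pr andbT; apply/eqP => Er; move: hr; rewrite -Er; lia.
have hre : height w r = height w p.
  case: r pr rj hr rmin below p1r => // r pr rj hr _ below p1r.
  have := below r; rewrite ltnSn -ltnS p1r => /(_ isT).
  have rw : (r < size w)%N by lia.
  by move: hr; rewrite (heightS rw); case: nth; lia.
exists p, r; split=> //; [by rewrite leqnn|by lia|].
move=> x /andP[px xr].
case: (ltngtP p x) px => // [px _|<- //].
move: xr; rewrite leq_eqVlt => /predU1P[->|xr]; first by rewrite hre.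
by rewrite ltW // below // px.
Qed.

(** A reducible substring through [p] would end, after [p], at a height no smaller than that of
    [p]. *)
Lemma last_max_minus p : (p < size w)%N ->
    (forall x, (x <= size w)%N -> height w x <= height w p) ->
    (forall x, (p < x <= size w)%N -> height w x < height w p) ->
  ~~ nth false w p /\ ~~ deleted w p.
Proof.
move=> pw pmax plast; split.
  by have := plast p.+1; rewrite heightS //; case: nth => //; lia.
apply/deletedP => -[l [r [/andP[lp pr] rw hr hx]]].
have := hx p; have := plast r; lia.
Qed.

End SignWords.

Lemma reductionE x0 (s : seq (bool * nat)) :
  reduction s = [seq nth x0 s k | k <- iota 0 (size s) & ~~ deleted (map fst s) k].
Proof.
by rewrite /reduction filter_mask map_mask -/(mkseq (nth x0 s) _) mkseq_nth.
Qed.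

Section Reduction.
Variable s : seq (bool * nat).
Local Notation w := (map fst s).
Let x0 := (true, 0%N).

Let nth_w p : (p < size s)%N -> (nth x0 s p).1 = nth false w p.
Proof. by move=> ps; rewrite (nth_map x0). Qed.

Lemma plus_reduction0 :
    (forall x, (x <= size s)%N -> height w x <= height w 0) ->
  [seq x <- reduction s | x.1] = [::].
Proof.
move=> max0; rewrite (reductionE x0) filter_map -filter_predI.
rewrite (eq_in_filter (a2 := pred0)) ?filter_pred0 // => p.
rewrite mem_iota add0n => /andP[_ ps] /=; rewrite nth_w //.
case: (boolP (nth _ _ _)) => //= wp; rewrite (@first_max_plus_deleted _ 0) //.
  by rewrite size_map.
by move=> x; rewrite size_map => /max0.
Qed.

(** At the first maximum [p.+1], the sign [p] survives and every later [+] is cancelled: this is the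
    sign on which [f_i] acts. *)
Lemma plus_reductionS p : (p < size s)%N ->
    (forall x, (x <= size s)%N -> height w x <= height w p.+1) ->
    (forall x, (x <= p)%N -> height w x < height w p.+1) ->
  (nth x0 s p).1 /\ exists L, [seq x <- reduction s | x.1] = rcons L (nth x0 s p).
Proof.
move=> ps pmax pfst.
have pw : (p < size w)%N by rewrite size_map.
have [wp ndp] := first_max_plus pw pfst.
rewrite nth_w //; split=> //.
rewrite (reductionE x0) filter_map -filter_predI.
have -> : size s = (p.+1 + (size s - p.+1))%N by lia.
rewrite iotaD filter_cat add0n.
rewrite [X in _ ++ X](eq_in_filter (a2 := pred0)); last first.
  move=> x; rewrite mem_iota => /andP[px xs] /=; rewrite nth_w; last by lia.
  case: (boolP (nth _ _ _)) => //= wx; rewrite (@first_max_plus_deleted _ p.+1) //.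
    by rewrite size_map; lia.
  by move=> y; rewrite size_map => /pmax.
rewrite filter_pred0 cats0 -addn1 iotaD filter_cat /= add0n nth_w // wp ndp /=.
by rewrite cats1 map_rcons; eexists.
Qed.

Lemma minus_reduction0 :
    (forall x, (x <= size s)%N -> height w x <= height w (size s)) ->
  [seq x <- reduction s | ~~ x.1] = [::].
Proof.
move=> maxs; rewrite (reductionE x0) filter_map -filter_predI.
rewrite (eq_in_filter (a2 := pred0)) ?filter_pred0 // => p.
rewrite mem_iota add0n => /andP[_ ps] /=; rewrite nth_w //.
case: (boolP (nth _ _ _)) => //= wt; rewrite (@last_max_minus_deleted _ (size s)) //.
  by rewrite size_map ps leqnn.
by move=> x; rewrite size_map => /maxs.
Qed.

(** At the last maximum [p], the sign [p] survives and every earlier [-] is cancelled: this is the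
    sign on which [e_i] acts. *)
Lemma minus_reductionS p : (p < size s)%N ->
    (forall x, (x <= size s)%N -> height w x <= height w p) ->
    (forall x, (p < x <= size s)%N -> height w x < height w p) ->
  ~~ (nth x0 s p).1 /\
  exists L, [seq x <- reduction s | ~~ x.1] = nth x0 s p :: L.
Proof.
move=> ps pmax plst.
have pw : (p < size w)%N by rewrite size_map.
have [] := @last_max_minus w p pw; rewrite ?size_map // => wp ndp.
rewrite nth_w //; split=> //.
rewrite (reductionE x0) filter_map -filter_predI.
have -> : size s = (p + (size s - p.+1).+1)%N by lia.
rewrite iotaD filter_cat add0n.
rewrite [X in X ++ _](eq_in_filter (a2 := pred0)); last first.
  move=> x; rewrite mem_iota => /andP[_ xs] /=; rewrite nth_w; last by lia.
  case: (boolP (nth _ _ _)) => //= wx; rewrite (@last_max_minus_deleted _ p) //.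
    by rewrite size_map; lia.
  by move=> y; rewrite size_map => /pmax.
rewrite filter_pred0 /= nth_w // wp ndp /=.
by eexists.
Qed.

End Reduction.

(** * Signatures of regular partitions *)

Lemma last_argmin (f : nat -> int) N : exists r, [/\ (r <= N)%N,
  forall x, (x <= N)%N -> f r <= f x & forall x, (r < x <= N)%N -> f r < f x].
Proof.
elim: N => [|N [r [rN rmin rlast]]].
  by exists 0%N; split=> // x; [rewrite leqn0 => /eqP->|lia].
have [le|lt] := leP (f N.+1) (f r).
  exists N.+1; split=> // x; last by lia.
  by rewrite leq_eqVlt => /predU1P[-> //|]; rewrite ltnS => /rmin; apply: le_trans.
exists r; split=> [|x|x /andP[rx]]; first exact: leqW.
  by rewrite leq_eqVlt => /predU1P[->|]; [exact: ltW|rewrite ltnS => /rmin].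
rewrite leq_eqVlt => /predU1P[-> //|]; rewrite ltnS => xN.
by apply: rlast; rewrite rx.
Qed.

Lemma first_argmin (f : nat -> int) N : exists r, [/\ (r <= N)%N,
  forall x, (x <= N)%N -> f r <= f x & forall x, (x < r)%N -> f r < f x].
Proof.
elim: N => [|N [r [rN rmin rfst]]].
  by exists 0%N; split=> // x; rewrite leqn0 => /eqP->.
have [lt|le] := ltP (f N.+1) (f r).
  exists N.+1; split=> // x; last by rewrite ltnS => /rmin; apply: lt_le_trans.
  rewrite leq_eqVlt => /predU1P[-> //|]; rewrite ltnS => /rmin h.
  exact: le_trans (ltW lt) h.
exists r; split=> [|x|//]; first exact: leqW.
by rewrite leq_eqVlt => /predU1P[-> //|]; rewrite ltnS => /rmin.
Qed.

Section Columns.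
Variable b : seq nat.
Hypothesis reg_b : inY0 b.
Local Notation n := (size b).
Local Notation mu := (nth 0%N b).

Lemma regular_anti r s : (r <= s)%N -> (mu s <= mu r)%N.
Proof.
elim: s => [|s IHs]; first by rewrite leqn0 => /eqP->.
rewrite leq_eqVlt => /predU1P[-> //|]; rewrite ltnS => rs.
have [ns|sn] := leqP n s; first by rewrite nth_default //; lia.
by apply: leq_trans (IHs rs); apply/ltnW/regular_gt.
Qed.

Lemma regular_pos r : (0 < mu r)%N = (r < n)%N.
Proof.
have [rn|nr] := ltnP r n; last by rewrite nth_default.
exact: leq_ltn_trans (leq0n _) (regular_gt reg_b rn).
Qed.

Lemma colhP r c : (0 < c)%N -> (r < colh b c)%N = (c <= mu r)%N.
Proof.
move=> c0; have [rn|nr] := ltnP r n; last first.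
  rewrite (nth_default _ nr); apply/idP/idP; last by lia.
  by rewrite ltnNge (leq_trans (count_size _ _) nr).
rewrite /colh -{1}(mkseq_nth 0%N b) count_map count_iota_down //= => s s'.
by case/andP=> ss' _ cs; apply: leq_trans cs (regular_anti ss').
Qed.

Lemma colh_eq r c : (0 < c)%N -> (mu r < c)%N ->
  (forall s, s.+1 = r -> c <= mu s)%N -> colh b c = r.
Proof.
move=> c0 rc cs; apply/eqP; rewrite eqn_leq leqNgt colhP // -ltnNge rc /=.
by case: r rc cs => // r rc cs; rewrite colhP // cs.
Qed.

(** The row above is strictly longer, so the column just past row [r] ends directly above that
    row. *)
Lemma colh_add r : (r <= n)%N -> colh b (mu r).+1 = r.
Proof. by move=> rn; apply: colh_eq => // s sr; rewrite -sr; apply: regular_gt => //; lia. Qed.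

Lemma colh_remove r : (r < n)%N -> colh b (mu r) = r.+1.
Proof.
move=> rn; have r0 : (0 < mu r)%N by rewrite regular_pos.
by apply: colh_eq => // [|s [->] //]; apply: regular_gt.
Qed.

End Columns.

Section Signature.
Variables (i : nat) (b : seq nat).
Hypothesis i2 : (i < 2)%N.
Hypothesis reg_b : inY0 b.
Local Notation n := (size b).
Local Notation m := (head 0%N b).
Local Notation q := (diag_end b).
Local Notation mu := (nth 0%N b).
Local Notation D := (sgn_sum i b).
Local Notation N := (nsigns i b).

(** The last box of a nonempty row [r] has label [i] exactly when [diag_end b r + i] is odd; when
    this is even, the box that would follow has label [i]. *)
Definition row_sign (r : nat) : bool * nat :=
  if odd (q r + i) then (false, mu r) else (true, (mu r).+1).

Lemma row_sign_minus_lt r : (r < N)%N -> odd (q r + i) -> (r < n)%N.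
Proof.
rewrite /nsigns; have [//|nr] := ltnP r n; case: (boolP (odd (n + i))) => o rN.
  by lia.
by have -> : r = n; [move: rN => /=; lia | rewrite diag_end_out // (negPf o)].
Qed.

Lemma row_sign_plus_lt r : (r <= n)%N -> ~~ odd (q r + i) -> (r < N)%N.
Proof.
rewrite leq_eqVlt /nsigns => /predU1P[->|]; last by lia.
by rewrite diag_end_out // => ->; lia.
Qed.

(** Both sides have strictly increasing columns, so it suffices to compare their elements. Rows come
    in reverse because lower rows end further left. *)
Lemma signature_rows :
  signature 0 i b = [seq row_sign r | r <- rev (iota 0 N)].
Proof.
pose lt2 : rel (bool * nat) := relpre snd ltn.
have tr : transitive lt2 by move=> y x z; apply: (@ltn_trans y.2).
have ir : irreflexive lt2 by move=> x; rewrite /lt2 /= ltnn.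
apply: (irr_sorted_eq tr ir).
- rewrite -sorted_map.
  suff -> : map snd (signature 0 i b)
      = [seq c <- iota 1 m.+1 | addable 0 i b c || removable 0 i b c].
    by apply: sorted_filter (iota_ltn_sorted _ _); apply: ltn_trans.
  rewrite /signature; elim: (iota _ _) => //= c cs IHcs.
  by rewrite map_cat IHcs; case: addable => //=; case: removable.
- rewrite -sorted_map -map_comp map_rev rev_sorted.
  apply/(sortedP 0%N) => r; rewrite size_map size_iota => rN.
  have rn : (r < n)%N by have := nsigns_le i b; lia.
  rewrite !(nth_map 0%N) ?size_iota //; last exact: ltnW.
  rewrite !nth_iota //; last exact: ltnW.
  (* Neighbouring rows whose lengths differ by one end on the same antidiagonal and carry the same
     sign, so their columns stay distinct. *)
  have := regular_gt reg_b rn; rewrite /= /row_sign !add0n /diag_end.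
  case: ifPn => o1; case: ifPn => o2 /=; lia.
move=> [s c]; apply/flatten_mapP/mapP => [[c' ]|[r]].
  rewrite mem_iota => /andP[c0 _].
  case: ifP => [/andP[ac /eqP lb]|_].
    rewrite inE => /eqP[-> ->]; set r := colh b c' in ac lb *.
    have := colhP reg_b r c0; rewrite ltnn => /esym/negbT; rewrite -ltnNge => mu_c.
    have En : (mu r).+1 = c'.
      move: ac; have [c1 _|c1 /=] := eqVneq c' 1%N; first by lia.
      by rewrite colhP; lia.
    have o : ~~ odd (q r + i) by move: lb; rewrite /label /diag_end; lia.
    exists r; last by rewrite /row_sign (negPf o) En.
    rewrite mem_rev mem_iota add0n /=; apply: row_sign_plus_lt => //.
    exact: count_size.
  case: ifP => // /and3P[h0 h1 /eqP lb]; rewrite inE => /eqP[-> ->].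
  case Er : (colh b c') h0 h1 lb => [//|r] _ h1 lb.
  have c_mu : (c' <= mu r)%N by rewrite -colhP // Er.
  have mu_c : (mu r <= c')%N by rewrite -ltnS ltnNge -(colhP reg_b r (ltn0Sn c')); lia.
  have En : mu r = c' by lia.
  have o : odd (q r + i) by move: lb; rewrite /label /diag_end; lia.
  exists r; last by rewrite /row_sign o En.
  by rewrite mem_rev mem_iota add0n /= /nsigns ltn_addr // -(regular_pos reg_b) En.
rewrite mem_rev mem_iota add0n => /andP[_ rN]; rewrite /row_sign.
have rn : (r <= n)%N by have := nsigns_le i b; lia.
have mur := regular_anti reg_b (leq0n r); rewrite nth0 in mur.
case: ifPn => o [-> ->].
  have rn' := row_sign_minus_lt rN o.
  have r0 : (0 < mu r)%N by rewrite regular_pos.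
  exists (mu r); first by rewrite mem_iota; lia.
  rewrite ifN; last first.
    rewrite /addable negb_and colh_remove //; apply/orP; right.
    by move: o; rewrite /label /diag_end; lia.
  rewrite ifT ?inE ?eqxx // /removable colh_remove // colh_add //.
  by rewrite ltnSn /=; move: o; rewrite /label /diag_end; lia.
exists (mu r).+1; first by rewrite mem_iota; lia.
rewrite ifT ?inE ?eqxx // /addable colh_add //; apply/andP; split; last first.
  by move: o; rewrite /label /diag_end; lia.
case: (posnP (mu r)) => [->//|r0] /=.
by rewrite colh_remove ?ltnSn ?orbT // -(regular_pos reg_b).
Qed.

(** The signature lists the rows from the bottom, so up to a constant the height is [D] reversed and
    negated: its first maximum is the last minimum of [D], and conversely. *)
Lemma height_rows j : (j <= N)%N ->
  height (map fst (signature 0 i b)) j = D N - D (N - j).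
Proof.
rewrite signature_rows -map_comp.
elim: j => [|j IHj] jN; first by rewrite subn0 subrr /height take0.
rewrite heightS ?size_map ?size_rev ?size_iota // (nth_map 0%N) ?size_rev ?size_iota //.
rewrite IHj ?(ltnW jN) // nth_rev ?size_iota // nth_iota; last by lia.
have -> : (N - j)%N = (N - j.+1).+1 by lia.
by rewrite sgn_sumS -signr_odd add0n /= /row_sign; case: odd => /=; lia.
Qed.

Lemma size_signature : size (signature 0 i b) = N.
Proof. by rewrite signature_rows size_map size_rev size_iota. Qed.

Lemma nth_signature x0 r : (r < N)%N -> nth x0 (signature 0 i b) (N - r.+1) = row_sign r.
Proof.
move=> rN; rewrite signature_rows (nth_map 0%N) ?size_rev ?size_iota; last by lia.
rewrite nth_rev ?size_iota; last by lia.
by rewrite nth_iota; [congr row_sign; lia|lia].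
Qed.

Lemma cfP : exists r, [/\ (r <= N)%N, forall x, (x <= N)%N -> D r <= D x,
  forall x, (r < x <= N)%N -> D r < D x
  & cf 0 i b = if (r < N)%N then Some (add_box b (mu r).+1) else None].
Proof.
have [r [rN rmin rlast]] := last_argmin D N; exists r; split=> //.
rewrite /cf; case: ltnP => [ltrN|leNr].
  have pN : (N - r.+1 < size (signature 0 i b))%N by rewrite size_signature; lia.
  have [] := plus_reductionS pN.
  - move=> x; rewrite size_signature => xN; rewrite !height_rows; [|lia..].
    have := rmin (N - x)%N.
    by rewrite (_ : (N - (N - r.+1).+1 = r)%N); lia.
  - move=> x xN; rewrite !height_rows; [|lia..].
    have := rlast (N - x)%N.
    by rewrite (_ : (N - (N - r.+1).+1 = r)%N); lia.
  rewrite nth_signature // /row_sign; case: ifP => // o _ [L ->].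
  by rewrite last_rcons; case: L.
rewrite plus_reduction0 // size_signature => x xN; rewrite !height_rows // subn0.
by have <- : r = N; [lia|have := rmin (r - x)%N; lia].
Qed.

Lemma ceP : exists r, [/\ (r <= N)%N, forall x, (x <= N)%N -> D r <= D x,
  forall x, (x < r)%N -> D r < D x
  & ce 0 i b = if r is r'.+1 then Some (remove_box b (mu r')) else None].
Proof.
have [r [rN rmin rfst]] := first_argmin D N; exists r; split=> //.
rewrite /ce; case: r rN rmin rfst => [|r] rN rmin rfst.
  rewrite minus_reduction0 // size_signature => x xN; rewrite !height_rows //.
  by rewrite subnn; have := rmin (N - x)%N; lia.
have pN : (N - r.+1 < size (signature 0 i b))%N by rewrite size_signature; lia.
have [] := minus_reductionS pN.
- move=> x; rewrite size_signature => xN; rewrite !height_rows; [|lia..].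
  have := rmin (N - x)%N.
    by rewrite (_ : (N - (N - r.+1) = r.+1)%N); lia.
- move=> x; rewrite size_signature => xN; rewrite !height_rows; [|lia..].
  have := rfst (N - x)%N.
    by rewrite (_ : (N - (N - r.+1) = r.+1)%N); lia.
by rewrite nth_signature // /row_sign; case: ifP => // o _ [L ->].
Qed.

End Signature.

(** * The LS path of a regular partition *)

Section WeightTheory.
Variable F : fieldType.
Implicit Types (u v : wt F) (a : F).

Lemma pairc_linear a u v j : pairc (a *: u + v) j = a * pairc u j + pairc v j.
Proof. by rewrite /pairc /wcoord !mxE; case: odd; ring. Qed.

Lemma pairc0 j : pairc (0 : wt F) j = 0.
Proof. by rewrite /pairc /wcoord !mxE; case: odd; ring. Qed.

Lemma paircD u v j : pairc (u + v) j = pairc u j + pairc v j.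
Proof. by rewrite -[u]scale1r pairc_linear mul1r scale1r. Qed.

Lemma paircZ a u j : pairc (a *: u) j = a * pairc u j.
Proof. by rewrite -[a *: u]addr0 pairc_linear pairc0 addr0. Qed.

Lemma paircB u v j : pairc (u - v) j = pairc u j - pairc v j.
Proof. by rewrite -scaleN1r paircD paircZ mulN1r. Qed.

Lemma pairc_sum (I : Type) (r : seq I) (P : pred I) (G : I -> wt F) j :
  pairc (\sum_(k <- r | P k) G k) j = \sum_(k <- r | P k) pairc (G k) j.
Proof.
by apply: (big_morph (fun v => pairc v j)); [move=> u v; apply: paircD|exact: pairc0].
Qed.

Lemma wcoord_mkw (c x y : F) k : (k < 3)%N ->
  wcoord (mkw c x y) k = if k == 0%N then c else if k == 1%N then x else y.
Proof. by move=> k3; rewrite /wcoord mxE inordK. Qed.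

Lemma pairc_Lam0 j : pairc (Lam0 F) j = (~~ odd j)%:R.
Proof. by rewrite /pairc !wcoord_mkw //=; case: odd => /=; ring. Qed.

Lemma pairc_alpha k j : pairc (alpha F k) j = 2 * (-1) ^+ (k + j).
Proof.
rewrite -signr_odd oddD /pairc /alpha.
by case: (odd k); case: (odd j); rewrite !wcoord_mkw //=; ring.
Qed.

Lemma pairc_wLam k j :
  pairc (wLam F k) j = if odd (k + j) then - k%:R else k.+1%:R.
Proof.
elim: k j => [|k IHk] j; first by rewrite pairc_Lam0 add0n; case: odd; rewrite ?oppr0.
rewrite /= /sref paircB paircZ !IHk addnn odd_double /= pairc_alpha -signr_odd.
by case: (odd (k + j)) => /=; rewrite -!natr1; ring.
Qed.

Lemma wLamS k : wLam F k.+1 = wLam F k - k.+1%:R *: alpha F k.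
Proof. by rewrite /= /sref pairc_wLam addnn odd_double. Qed.

Lemma wLam_sum k :
  wLam F k = Lam0 F - \sum_(1 <= j < k.+1) j%:R *: alpha F j.-1.
Proof.
elim: k => [|k IHk]; first by rewrite big_geq // subr0.
by rewrite wLamS IHk [in RHS]big_nat_recr //= opprD addrA.
Qed.

End WeightTheory.

Lemma abel_scale (R : pzRingType) (V : lmodType R) (g : nat -> R) (v : nat -> V) L :
  \sum_(0 <= j < L.+1) (g j.+1 - g j) *: v j =
  g L.+1 *: v L - g 0%N *: v 0%N - \sum_(0 <= j < L) g j.+1 *: (v j.+1 - v j).
Proof.
elim: L => [|L IHL]; first by rewrite big_nat1 big_geq // subr0 scalerBl.
rewrite big_nat_recr //= IHL [in RHS]big_nat_recr //= scalerBl scalerBr.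
set x := _ *: _; set y := _ *: v 0%N; set z := _ *: _; set u := \sum_(_ <= _ < _) _.
by rewrite !opprD !opprK !addrA (ACl (4*2*3*5*1)) //=.
Qed.

(* The junction of the segments of directions w_k and w_(k-1) in the LS path. *)
Definition brk (F : fieldType) (b : seq nat) (k : nat) : F :=
  if (k <= size b)%N then 1 else (diag_len b k)%:R / k%:R.

Section PsiPath.
Variable b : seq nat.
Hypothesis reg_b : inY0 b.
Local Notation n := (size b).
Local Notation m := (head 0%N b).
Local Notation len := (diag_len b).

(** Row [r] minus its staircase part [n - r] keeps at least [k - n] boxes exactly when the row
    reaches antidiagonal [k], so the conjugate parts are antidiagonal lengths. *)
Lemma PsiE : Psi b = LSD (rev (iota n (m - n).+1))
  [seq (len k)%:R / k%:R | k <- rev (iota n.+1 (m - n))].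
Proof.
congr LSD; apply/eq_in_map => k; rewrite mem_rev mem_iota => /andP[nk _].
congr (_%:R / _); rewrite count_map /diag_len -[in RHS](subnKC (ltnW nk)) iotaD.
rewrite count_cat (subnKC (ltnW nk)) add0n.
rewrite [X in (_ + X)%N](eq_in_count (a2 := pred0)); last first.
  by move=> r; rewrite mem_iota => nr /=; rewrite diag_end_out; lia.
rewrite count_pred0 addn0; apply/eq_in_count => r; rewrite mem_iota /= => rn.
by have := diag_end_size reg_b (r := r); rewrite /diag_end; lia.
Qed.

Lemma Psi_breaks :
  0 :: lbr (Psi b) ++ [:: 1] = [seq brk rat b k | k <- rev (iota n (m - n).+2)].
Proof.
have nm := size_le_head reg_b.
have -> : iota n (m - n).+2 = n :: (iota n.+1 (m - n) ++ [:: m.+1]).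
  have <- : (n.+1 + (m - n) = m.+1)%N by lia.
  by rewrite -(iotaD n.+1 (m - n) 1) addn1.
rewrite PsiE rev_cons rev_cat map_rcons -cats1 /=.
have -> : brk rat b m.+1 = 0 by rewrite /brk ifN ?diag_len0 ?mul0r //; lia.
have -> : brk rat b n = 1 by rewrite /brk leqnn.
congr (_ :: _ ++ _); apply/eq_in_map => k.
by rewrite mem_rev mem_iota /brk => nk; rewrite ifN //; lia.
Qed.

(** The numerator does not grow and the denominator does; row 0 keeps [len k] positive up to
    [k = m]. At [k = n] the numerator [len n.+1] is at most [n]. *)
Lemma brk_lt (F : numFieldType) k : (n <= k <= m)%N -> brk F b k.+1 < brk F b k.
Proof.
move=> /andP[nk km]; rewrite /brk ifN -?ltnNge ?ltnS //.
case: ifP => [kn|/negbT].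
  have -> : k = n by lia.
  rewrite ltr_pdivrMr ?ltr0n // mul1r ltr_nat ltnS.
  exact: diag_len_size.
rewrite -ltnNge => nk1.
rewrite ltr_pdivrMr ?ltr0n // mulrAC ltr_pdivlMr ?ltr0n; last by lia.
rewrite -!natrM ltr_nat; have := diag_len_mono reg_b nk.
have : (0 < len k)%N by rewrite diag_lenP //; [rewrite /diag_end nth0 addn0|lia].
by nia.
Qed.

End PsiPath.

(** The value is that of [pairc_wLam], matching the expansion [wLam_sum]. It collects the
    antidiagonals still growing at time [t]. *)
Lemma sum_alt_id (R : comPzRingType) i K :
  (~~ odd i)%:R + 2 * \sum_(1 <= k < K.+1) (-1) ^+ (k + i) * k%:R
    = (if odd (K + i) then - K%:R else K.+1%:R) :> R.
Proof.
elim: K => [|K IHK].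
  by rewrite big_geq // mulr0 addr0 add0n; case: odd; rewrite ?oppr0.
rewrite big_nat_recr //= mulrDr addrA IHK -signr_odd addSn /=.
by case: odd => /=; rewrite -!natr1; ring.
Qed.

(** * The path and its pairings in terms of antidiagonals *)

Section PathFormula.
Variables (R : realType) (b : seq nat).
Hypothesis reg_b : inY0 b.
Local Notation n := (size b).
Local Notation m := (head 0%N b).
Local Notation len := (diag_len b).
Local Notation D i := (sgn_sum i b).

(* Along the path the antidiagonals fill up simultaneously, the k-th one at
   speed k until all its boxes are reached. *)
Lemma lspath_diag (t : R) M : 0 <= t <= 1 -> (m < M)%N ->
  lspath R (Psi b) t = t *: Lam0 R
    - \sum_(1 <= k < M) Num.min (k%:R * t) (len k)%:R *: alpha R k.-1.
Proof.
move=> /andP[t0 t1] mM; have nm := size_le_head reg_b.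
rewrite /lspath Psi_breaks // -map_comp.
rewrite -[lsig _]/(rev (iota n (m - n).+1)) size_rev size_iota.
set A := map _ _.
(* [g j] cuts the [j]-th break point off at [t], so its increments are the times spent in each
   direction before [t]. *)
pose g j := Num.min t (nth 0 A j).
have nthA j : (j <= (m - n).+1)%N -> nth 0 A j = brk R b (m.+1 - j).
  move=> jL; rewrite /A (nth_map 0%N) ?size_rev ?size_iota // nth_rev ?size_iota //.
  rewrite nth_iota; last by lia.
  have -> : (n + ((m - n).+2 - j.+1) = m.+1 - j)%N by lia.
  rewrite /= /brk; case: ifP => _; first by rewrite rmorph1.
  by rewrite fmorph_div /= !ratr_nat.
have stepA j : (j < (m - n).+1)%N -> nth 0 A j < nth 0 A j.+1.
  move=> jL; rewrite !nthA //; last exact: ltnW.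
  have -> : (m.+1 - j = (m.+1 - j.+1).+1)%N by lia.
  by apply: brk_lt => //; lia.
rewrite -(big_mkord xpredT (fun j => (Num.min (Num.max t (nth 0 A j)) (nth 0 A j.+1)
  - nth 0 A j) *: wLam R (nth 0%N (rev (iota n (m - n).+1)) j))).
rewrite (eq_big_nat _ _ (F2 := fun j => (g j.+1 - g j) *: wLam R (m - j))); last first.
  move=> j /andP[_ jL]; congr (_ *: wLam R _).
    rewrite /g; have := stepA j jL.
    by rewrite !minEle !maxEle; do ![case: ifPn; rewrite -?ltNge]; lra.
  by rewrite nth_rev ?size_iota // nth_iota; lia.
rewrite (abel_scale g (fun j => wLam R (m - j))) subn0.
have -> : g 0%N = 0.
  by rewrite /g nthA // subn0 /brk ifN ?diag_len0 // ?mul0r ?min_r //; lia.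
have -> : g (m - n).+1 = t.
  rewrite /g nthA // (_ : m.+1 - (m - n).+1 = n)%N; last by lia.
  by rewrite /brk leqnn min_l.
have -> : (m - (m - n) = n)%N by lia.
rewrite scale0r subr0 wLam_sum scalerBr -addrA -opprD; congr (_ - _).
rewrite (@big_cat_nat _ _ _ m.+1 1%N M) //=.
rewrite [X in _ = _ + X]big_nat [X in _ = _ + X]big1 ?addr0; last first.
  move=> k /andP[mk _]; rewrite diag_len0 // min_r ?scale0r //.
  by rewrite mulr_ge0 // ler0n.
rewrite (@big_cat_nat _ _ _ n.+1 1%N m.+1) //=; congr (_ + _).
  rewrite scaler_sumr; apply: eq_big_nat => k /andP[_ kn].
  by rewrite scalerA [t * _]mulrC diag_len_full // min_l // ler_piMr // ler0n.
(* The directions run from [w_m] down to [w_n], hence the reversal of the sum over antidiagonals. *)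
rewrite [RHS]big_nat_rev /= -[n.+1]add0n big_addn.
have -> : (m.+1 - n.+1 = m - n)%N by lia.
apply: eq_big_nat => j /andP[_ jL].
have -> : (0 + n.+1 + m.+1 - (j + n.+1).+1 = (m - j.+1).+1)%N by lia.
have -> : (m - j = (m - j.+1).+1)%N by lia.
set k := (m - j.+1)%N.
rewrite wLamS opprB addrC subrK scalerA; congr (_ *: _).
rewrite /g nthA; last by lia.
have -> : (m.+1 - j.+1 = k.+1)%N by lia.
rewrite /brk ifN; last by lia.
by rewrite minr_pMl ?ler0n // divfK ?pnatr_eq0 // mulrC.
Qed.

(** On this piece the antidiagonals up to [K] still grow and the later ones are complete. Each case
    is written from the lower end of the piece: slope [-K] towards [D i (len K)], or slope [K.+1]
    from [D i (len K.+1)]. *)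
Lemma pairc_path_segment i K (t : R) : (i < 2)%N -> 0 <= t <= 1 -> (n <= K)%N ->
    (len K.+1)%:R <= K.+1%:R * t -> K%:R * t <= (len K)%:R ->
  pairc (lspath R (Psi b) t) i =
    if odd (K + i) then (len K)%:R - K%:R * t + (D i (len K))%:~R
    else K.+1%:R * t - (len K.+1)%:R + (D i (len K.+1))%:~R.
Proof.
move=> i2 t01 nK hK1 hK; have /andP[t0 t1] := t01.
pose M := (m + K).+2.
have mM : (m < M)%N by rewrite /M; lia.
rewrite (lspath_diag t01 mM) paircB paircZ pairc_sum pairc_Lam0.
rewrite (@big_cat_nat _ _ _ K.+1 1%N M) //=; last by rewrite /M; lia.
(* Going down from [K], [k * t] does not increase and the lengths do not decrease, as far as [n]; up
   to [n] the antidiagonals are full. *)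
have below k : (k <= K)%N -> k%:R * t <= (len k)%:R.
  have [kn|nk] := leqP k n.
    by move=> _; rewrite diag_len_full // ler_piMr // ler0n.
  have [d] := ubnP (K - k)%N; elim: d => // d IHd in k nk *.
  rewrite [(k <= K)%N]leq_eqVlt => dk /predU1P[->//|kK].
  have h : k.+1%:R * t <= (len k.+1)%:R by apply: IHd; lia.
  apply: le_trans (le_trans h _); last by rewrite ler_nat diag_len_mono // ltnW.
  by rewrite ler_wpM2r // ler_nat.
have above k : (K < k)%N -> (len k)%:R <= k%:R * t.
  elim: k => // k IHk; rewrite ltnS leq_eqVlt => /predU1P[<-//|Kk].
  apply: le_trans (le_trans (IHk Kk) _); first by rewrite ler_nat diag_len_mono //; lia.
  by rewrite ler_wpM2r // ler_nat.
rewrite (eq_big_nat _ _ (F2 := fun k => - (2 * t) * ((-1) ^+ (k + i) * k%:R))); last first.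
  move=> [|k] // /andP[_ kK]; rewrite paircZ pairc_alpha min_l ?below //.
  by rewrite addSn exprS; ring.
rewrite [X in _ - (_ + X)](eq_big_nat _ _ (F2 := fun k =>
    - 2 * ((-1) ^+ (k + i) * (len k)%:Z)%:~R)); last first.
  move=> [|k] // /andP[kK _]; rewrite paircZ pairc_alpha min_r ?above //.
  by rewrite intrM rmorphXn /= rmorphN1 addSn exprS -pmulrn; ring.
rewrite -!mulr_sumr -rmorph_sum.
have kM : (n <= K.+1 <= M)%N by rewrite /M; lia.
have E := congr1 (fun z : int => z%:~R : R) (sgn_sum_diag i reg_b mM kM).
rewrite intrM in E.
have S := sum_alt_id R i K.
set S1 := \sum_(1 <= k < K.+1) _ in S *.
set S2 := (\sum_(K.+1 <= k < M) _)%:~R in E *.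
have -> : t * (~~ odd i)%:R - (- (2 * t) * S1 + -2 * S2)
  = t * ((~~ odd i)%:R + 2 * S1) + 2%:~R * S2.
  by rewrite -[2%:~R]/2; ring.
(* For odd [K + i] the block identity passes from [len K.+1] to [len K]. *)
rewrite S E; have := sgn_sum_block i reg_b nK.
by rewrite -(signr_odd _ (K + i)) -(signr_odd _ (K.+1 + i)) addSn /=;
  case: odd => /= [->|_]; ring.
Qed.

End PathFormula.

(** * Root operators *)

Lemma regularI p :
  (forall r, r < size p -> nth 0 p r.+1 < nth 0 p r)%N -> inY0 p.
Proof.
move=> dec; apply/andP; split.
  by apply/(sortedP 0%N) => r rp; apply/dec/ltnW.
by apply/(all_nthP 0%N) => r /dec; apply: leq_ltn_trans.
Qed.

(** The hypothesis pushes all zeros to the tail, where the default value of [nth] reproduces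
    them. *)
Lemma nth_filter_pos s :
    (forall r, nth 0 s r.+1 < nth 0 s r \/ nth 0 s r = 0 /\ nth 0 s r.+1 = 0)%N ->
  forall r, nth 0%N [seq x <- s | 0 < x]%N r = nth 0%N s r.
Proof.
elim: s => //= a s IHs dec.
have {}IHs := IHs (fun r => dec r.+1); case: posnP => [a0|a0] r /=.
  have z x : nth 0%N (a :: s) x = 0%N.
    by elim: x => // x IHx; case: (dec x); rewrite IHx // => -[].
  by rewrite IHs z -[RHS](z r.+1).
by case: r => //= r; apply: IHs.
Qed.

Lemma regular_filter_pos s :
    (forall r, nth 0 s r.+1 < nth 0 s r \/ nth 0 s r = 0 /\ nth 0 s r.+1 = 0)%N ->
  inY0 [seq x <- s | 0 < x]%N.
Proof.
move=> dec; apply: regularI => r rs; rewrite !nth_filter_pos //.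
have := dec r; have := mem_nth 0%N rs; rewrite mem_filter nth_filter_pos //.
by case/andP=> pos _ [//|[]]; lia.
Qed.

(** A box put at the end of row [r] lies on the antidiagonal following [diag_end b r]. *)
Lemma diag_len_incr b b' r :
    (forall x, nth 0 b' x = nth 0 b x + (x == r))%N ->
  forall k, diag_len b' k = (diag_len b k + (k == (diag_end b r).+1))%N.
Proof.
move=> b'E k.
have -> : (k == (diag_end b r).+1)
    = count (fun x => (x == r) && (k == (diag_end b r).+1)) (iota 0 k) :> nat.
  have [->|_] := eqVneq k; last first.
    by rewrite (eq_count (a2 := pred0)) ?count_pred0 // => x; rewrite andbF.
  rewrite (eq_count (a2 := pred1 r)); last by move=> x; rewrite andbT.
  by rewrite count_uniq_mem ?iota_uniq // mem_iota add0n ltnS diag_end_ge.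
rewrite /diag_len; elim: (iota 0 k) => //= x s ->.
rewrite /diag_end b'E; have [->|_] := eqVneq x r; lia.
Qed.

Section BoxMoves.
Variables (R : realType) (b : seq nat).
Hypothesis reg_b : inY0 b.
Local Notation n := (size b).
Local Notation q := (diag_end b).
Local Notation mu := (nth 0%N b).

Lemma lspath_incr b' r (t : R) : inY0 b' ->
    (forall x, nth 0 b' x = nth 0 b x + (x == r))%N -> 0 <= t <= 1 ->
  let k := (q r).+1 in
  lspath R (Psi b') t = lspath R (Psi b) t
    - (Num.min (k%:R * t) (diag_len b k).+1%:R
       - Num.min (k%:R * t) (diag_len b k)%:R) *: alpha R k.-1.
Proof.
move=> reg_b' b'E t01 k.
(* A bound common to both partitions allows a comparison term by term; only term [k] differs. *)
pose M := (head 0 b + head 0 b' + k).+1%N.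
rewrite !(@lspath_diag _ _ _ t M) //; [|rewrite /M; lia..].
have kM : k \in index_iota 1 M by rewrite mem_index_iota /M; lia.
rewrite !(bigD1_seq k kM (iota_uniq _ _)) /= (diag_len_incr b'E) eqxx addn1.
rewrite (eq_bigr (fun j => Num.min (j%:R * t) (diag_len b j)%:R *: alpha R j.-1)); last first.
  by move=> j jk; rewrite (diag_len_incr b'E) (negPf jk) addn0.
rewrite -addrA; congr (_ + _); rewrite -opprD; congr (- _).
by rewrite scalerBl [RHS]addrC subrKA.
Qed.

(** The condition on the preceding row says that its part exceeds [mu r] by at least two, so the
    parts stay distinct. *)
Lemma add_boxP r : (r <= n)%N -> (forall s, s.+1 = r -> q r < q s)%N ->
  (forall x, nth 0 (add_box b (mu r).+1) x = mu x + (x == r))%N /\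
  inY0 (add_box b (mu r).+1).
Proof.
move=> rn prev; rewrite /add_box colh_add //=.
have nthE x : nth 0%N (set_nth 0%N b r (mu r).+1) x = (mu x + (x == r))%N.
  by rewrite nth_set_nth /=; have [->|_] := eqVneq x r; rewrite ?addn1 ?addn0.
split=> //; apply: regularI => x; rewrite size_set_nth !nthE => xs.
have := prev x; rewrite /diag_end.
have [xn|nx] := ltnP x n; last by rewrite !nth_default; lia.
by have := regular_gt reg_b xn; have [<-|_] := eqVneq x.+1 r; lia.
Qed.

Lemma remove_boxP r : (r < n)%N -> (r.+1 < n -> q r.+1 < q r)%N ->
  (forall x, mu x = nth 0 (remove_box b (mu r)) x + (x == r))%N /\
  inY0 (remove_box b (mu r)).
Proof.
move=> rn next; rewrite /remove_box colh_remove //=.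
have r0 : (0 < mu r)%N by rewrite regular_pos.
set s := set_nth _ _ _ _.
have nthE x : nth 0%N s x = (mu x - (x == r))%N.
  by rewrite nth_set_nth /=; have [->|_] := eqVneq x r; rewrite ?subn1 ?subn0.
have dec x : (nth 0 s x.+1 < nth 0 s x \/ nth 0 s x = 0 /\ nth 0 s x.+1 = 0)%N.
  rewrite !nthE; have [xn|nx] := ltnP x n; last first.
    by right; rewrite !nth_default //; lia.
  have := regular_gt reg_b xn; have [->|xr] := eqVneq x r; last by lia.
  have [r1n|r1n] := ltnP r.+1 n; first by have := next r1n; rewrite /diag_end; lia.
  (* The last row may shrink to a zero part, which the filter drops. *)
  by rewrite (nth_default _ r1n); lia.
split; last exact: regular_filter_pos.
by move=> x; rewrite nth_filter_pos // nthE; have [->|_] := eqVneq x r; lia.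
Qed.

End BoxMoves.

(** * Minima of the pairing along the path, and the operators [f_i] and [e_i] *)

Section RootOperators.
Variables (R : realType) (b : seq nat) (i : nat).
Hypotheses (reg_b : inY0 b) (i2 : (i < 2)%N).
Local Notation n := (size b).
Local Notation m := (head 0%N b).
Local Notation q := (diag_end b).
Local Notation mu := (nth 0%N b).
Local Notation len := (diag_len b).
Local Notation D := (sgn_sum i b).
Local Notation N := (nsigns i b).
Local Notation h t := (pairc (lspath R (Psi b) t) i).

(** [K] is minimal for the first inequality. Failure at its predecessor gives the second one, which
    for [K = n] reads [n * t <= n]. *)
Lemma segment_exists (t : R) : 0 <= t <= 1 -> exists K, [/\ (n <= K)%N,
  (len K.+1)%:R <= K.+1%:R * t & K%:R * t <= (len K)%:R].
Proof.
move=> /andP[t0 t1].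
pose P K := (n <= K)%N && ((len K.+1)%:R <= K.+1%:R * t).
have exP : exists K, P K.
  by exists m; rewrite /P size_le_head // diag_len0 // mulr_ge0 // ler0n.
case: (ex_minnP exP) => K /andP[nK hK] Kmin; exists K; split=> //.
move: nK; rewrite leq_eqVlt => /predU1P[<-|nK].
  by rewrite diag_len_full // ler_piMr // ler0n.
case: K nK hK Kmin => // K nK hK Kmin.
have := Kmin K; rewrite /P -ltnS nK /= ltnn; case: leP => [_ /(_ isT) //|lt _].
exact: ltW.
Qed.

(** On each linear piece the bound is the value at one end, where [k + i] is odd: [k = K] on falling
    pieces, [k = K.+1] on rising ones. *)
Lemma path_lower (t : R) : 0 <= t <= 1 -> exists k, [/\ (n <= k)%N, odd (k + i),
  (D (len k))%:~R <= h t & h t = (D (len k))%:~R -> k%:R * t = (len k)%:R].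
Proof.
move=> t01; have [K [nK hK1 hK]] := segment_exists t01.
rewrite (pairc_path_segment reg_b i2 t01 nK hK1 hK).
case: (boolP (odd (K + i))) => o; [exists K|exists K.+1]; split=> //;
  [lra|lra|exact: leqW|lra|lra].
Qed.

Lemma path_start : h 0 = 0.
Proof.
rewrite (@lspath_diag _ _ reg_b _ m.+1) ?lexx ?ler01 // scale0r sub0r.
rewrite big_nat big1 ?oppr0 ?pairc0 // => k _.
by rewrite mulr0 min_l ?scale0r // ler0n.
Qed.

Lemma path_end : h 1 = (D N)%:~R.
Proof.
have ln := diag_len_size reg_b (leqnSn n).
rewrite (@pairc_path_segment _ _ _ i n) ?mulr1 ?lexx ?ler01 // ?ler_nat.
- rewrite sgn_sum_last // diag_len_full //; case: odd; first by rewrite subrr add0r.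
  ring.
- exact: leqW.
- by rewrite diag_len_full.
Qed.

Lemma len_le_nsigns k : (n <= k)%N -> (len k <= N)%N.
Proof. by move=> nk; rewrite (leq_trans (diag_len_size _ nk)) // leq_addr. Qed.

Lemma path_ge r : (forall x, (x <= N)%N -> D r <= D x) ->
  forall t : R, 0 <= t <= 1 -> (D r)%:~R <= h t.
Proof.
move=> rmin t t01; have [k [nk _ hk _]] := path_lower t01.
by apply: le_trans hk; rewrite ler_int rmin // len_le_nsigns.
Qed.

(** The lower bound of [path_lower] is itself at least [D r], so equality holds and fixes the
    position of [t]. *)
Lemma path_eq_min r (t : R) : (forall x, (x <= N)%N -> D r <= D x) ->
    0 <= t <= 1 -> h t = (D r)%:~R ->
  exists k, [/\ (n <= k)%N, odd (k + i), D (len k) = D r & k%:R * t = (len k)%:R].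
Proof.
move=> rmin t01 ht; have [k [nk o hk hkE]] := path_lower t01.
have E : D (len k) = D r.
  by apply/eqP; rewrite eq_le rmin ?len_le_nsigns // -(ler_int R) -ht hk.
by exists k; split=> //; apply: hkE; rewrite E.
Qed.

Lemma alpha_parity k : ~~ odd (k + i) -> alpha R k = alpha R i.
Proof. by rewrite oddD /alpha; case: odd; case: odd. Qed.

(** With [r] the last minimum of [D], the new box lies on antidiagonal [k0], just after the end of
    row [r]. On [[r / k0, (r + 1) / k0]] the pairing climbs by one from its last minimum. The change
    of the path due to the box is the reflection of this piece and the shift of the rest. *)
Lemma Lf_Psi :
  (if cf 0 i b is Some b' then inY0 b' else True) /\
  Lf i (lspath R (Psi b)) (omap (fun b' => lspath R (Psi b')) (cf 0 i b)).
Proof.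
have [r [rN rmin rlast ->]] := cfP i2 reg_b.
case: ltnP => [{}rN|Nr]; last first.
  split=> //; have {Nr}E : r = N by apply/eqP; rewrite eqn_leq rN.
  exists (h 1); split; last by left; rewrite subrr ltr01.
  split; first by exists 1; rewrite ler01 lexx.
  by move=> y [t [t01 <-]]; rewrite path_end -E; apply: path_ge.
have rn : (r <= n)%N by have := nsigns_le i b; lia.
(* [D] rises after its last minimum, so row [r] has sign [+]. *)
have o : ~~ odd (q r + i).
  have := rlast r.+1; rewrite leqnn rN sgn_sumS -signr_odd => /(_ isT).
  by case: odd => //=; lia.
(* [D] cannot rise into a minimum, so the row above has sign [-] and ends on an antidiagonal of the
   other parity. *)
have prev s : s.+1 = r -> (q r < q s)%N.
  move=> Er; have : odd (q s + i).
    have := rmin s; rewrite -Er sgn_sumS -signr_odd; case: odd => //=; lia.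
  have : (q r <= q s)%N by apply: diag_end_anti => //; lia.
  by rewrite leq_eqVlt => /predU1P[<-|//]; rewrite (negPf o).
have [b'E reg_b'] := add_boxP reg_b rn prev; split=> //.
have nq := diag_end_size reg_b rn.
set k0 := (q r).+1.
have rk0 : (r < k0)%N by rewrite ltnS diag_end_ge.
have lenk0 : len k0 = r.
  apply/eqP; rewrite eqn_leq leqNgt diag_lenP // ltnn /=.
  by case: r prev @k0 rk0 {rmin rlast rN rn o b'E reg_b' nq} => // s prev k0 rk0;
    rewrite diag_lenP ?prev //; apply: ltnW.
have k0_gt0 : 0 < k0%:R :> R by rewrite ltr0n.
pose t0 : R := r%:R / k0%:R; pose t1 : R := r.+1%:R / k0%:R.
have t0_ge0 : 0 <= t0 by rewrite divr_ge0 ?ler0n.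
have t01 : t0 <= t1 by rewrite ler_pM2r ?invr_gt0 // ler_nat.
have t1_le1 : t1 <= 1 by rewrite ler_pdivrMr // mul1r ler_nat.
have hseg t : t0 <= t -> t <= t1 -> h t = k0%:R * t - r%:R + (D r)%:~R.
  rewrite ler_pdivrMr // ler_pdivlMr // ![t * _]mulrC => tt0 tt1.
  have ht : 0 <= t <= 1.
    apply/andP; split; first by rewrite -(pmulr_rge0 _ k0_gt0) (le_trans _ tt0) ?ler0n.
    by rewrite -(ler_pM2l k0_gt0) mulr1 (le_trans tt1) // ler_nat.
  have /andP[ht0 ht1] := ht.
  rewrite (pairc_path_segment reg_b i2 ht nq) ?(negPf o) ?lenk0 //.
  move: rn; rewrite leq_eqVlt => /predU1P[Er|rn].
    by rewrite Er diag_end_out // diag_len_full // ler_piMr // ler0n.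
  apply: le_trans (_ : r.+1%:R <= _).
    by apply: le_trans tt1; rewrite ler_wpM2r // ler_nat.
  rewrite ler_nat diag_lenP //.
  by rewrite /diag_end -[X in (X < _)%N]add0n ltn_add2r regular_pos.
have ht0 : h t0 = (D r)%:~R by rewrite hseg // mulrC divfK ?gt_eqF // subrr add0r.
have ht1 : h t1 = (D r)%:~R + 1.
  by rewrite hseg // mulrC divfK ?gt_eqF // -natr1; ring.
exists (D r)%:~R; split.
  split; first by exists t0; rewrite t0_ge0 (le_trans t01).
  by move=> y [t [t01' <-]]; apply: path_ge.
right; split.
  rewrite path_end -rmorphB /= ler1z.
  by have := rlast N; rewrite rN leqnn => /(_ isT); lia.
exists t0, t1; split.
- split; first by rewrite t0_ge0 (le_trans t01).
  move=> t [t01' /(path_eq_min rmin t01')[k [nk ok Dk kt]]].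
  have lk : (len k <= r)%N.
    rewrite leqNgt; apply/negP => rl; have := rlast (len k).
    by rewrite rl len_le_nsigns // Dk ltxx => /(_ isT).
  (* If [k <= q r], either row [r] meets antidiagonal [k], against [lk], or [k = r = n], against the
     parities. With [lk] this gives [t = len k / k <= r / k0]. *)
  have k0k : (k0 <= k)%N.
    rewrite /k0 ltnNge; apply/negP => kq.
    have [rk|kr] := ltnP r k; first by move: kq; rewrite -diag_lenP // ltnNge lk.
    have En : r = n by lia.
    have Ek : k = n by lia.
    by move: o; rewrite En diag_end_out // -Ek ok.
  have /andP[t_ge0 _] := t01'.
  rewrite ler_pdivlMr // mulrC (le_trans (_ : _ <= k%:R * t)) //.
    by rewrite ler_wpM2r // ler_nat.
  by rewrite kt ler_nat.
- split; first by rewrite t01.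
  move=> t [/andP[tt0 _] ht]; rewrite leNgt; apply/negP => tt1.
  move: (tt1); rewrite ltr_pdivlMr // -natr1.
  by move: ht; rewrite hseg // ?ltW //; lra.
exists (lspath R (Psi (add_box b (mu r).+1))); split=> // t t01'.
rewrite (lspath_incr reg_b reg_b' b'E t01') -/k0 lenk0 /=.
rewrite (alpha_parity o).
(* The coefficient of [alpha R i] is zero up to [t0], equals [h t - h t0] up to [t1], and is one
   afterwards. *)
case: (leP t t0) => tt0.
  move: (tt0); rewrite ler_pdivlMr // mulrC => tt.
  by rewrite !min_l ?subrr ?scale0r ?subr0 // (le_trans tt) // ler_nat.
have tt0' : r%:R <= k0%:R * t by rewrite mulrC -ler_pdivrMr // ltW.
rewrite (min_r tt0'); case: (leP t t1) => tt1.
  rewrite min_l; last by rewrite mulrC -ler_pdivlMr.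
  rewrite /sref paircB ht0 hseg // ?ltW // addrK addrA.
  by rewrite [_ + (_ - _)]addrC subrK.
rewrite min_r; last by rewrite mulrC -ler_pdivrMr // ltW.
by rewrite -natr1 addrAC subrr add0r scale1r.
Qed.

(** With [r.+1] the first minimum of [D], row [r] has sign [-] and loses its last box, on
    antidiagonal [k0 = q r]. On [[r / k0, (r + 1) / k0]] the pairing falls by one to its first
    minimum. The formula for adding a box is applied from [b'] to [b]. *)
Lemma Le_Psi :
  (if ce 0 i b is Some b' then inY0 b' else True) /\
  Le i (lspath R (Psi b)) (omap (fun b' => lspath R (Psi b')) (ce 0 i b)).
Proof.
have [[|r] [rN rmin rfst ->]] := ceP i2 reg_b.
  split=> //; exists 0; split; last by left; rewrite ltrN10.
  split; first by exists 0; rewrite lexx ler01 path_start.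
  move=> y [t [t01 <-]]; have := path_ge rmin t01.
  by rewrite /sgn_sum big_geq.
have o : odd (q r + i).
  have := rfst r; rewrite ltnSn sgn_sumS -signr_odd => /(_ isT).
  by case: odd => //=; lia.
have rn : (r < n)%N by apply: row_sign_minus_lt o.
have next : (r.+1 < n -> q r.+1 < q r)%N.
  move=> r1n; have : (q r.+1 <= q r)%N by apply: diag_end_anti => //; lia.
  rewrite leq_eqVlt => /predU1P[E|//].
  (* A next row on the same antidiagonal would also have sign [-] and take [D] below its minimum. *)
  have r2N : (r.+2 <= N)%N by rewrite (leq_trans r1n) // leq_addr.
  by have := rmin _ r2N; rewrite [D r.+2]sgn_sumS E -signr_odd o /=; lia.
have [bE reg_b'] := remove_boxP reg_b rn next; split=> //.
have nq := diag_end_size reg_b (ltnW rn).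
have rk0 : (r < q r)%N by rewrite /diag_end -[X in (X < _)%N]add0n ltn_add2r regular_pos.
set b' := remove_box b (mu r) in bE reg_b' *.
set k0 := q r in rk0 nq o *.
have lenk0 : len k0 = r.+1.
  apply/eqP; rewrite eqn_leq diag_lenP // leqnn andbT leqNgt; apply/negP => l1.
  have r1k0 := leq_trans l1 (diag_len_leq b k0).
  move: l1; rewrite diag_lenP // leqNgt => /negP; apply.
  have [/next //|nr] := ltnP r.+1 n; rewrite diag_end_out //.
have k0_gt0 : 0 < k0%:R :> R by rewrite ltr0n; lia.
pose t0 : R := r%:R / k0%:R; pose t1 : R := r.+1%:R / k0%:R.
have t0_ge0 : 0 <= t0 by rewrite divr_ge0 ?ler0n.
have t01 : t0 <= t1 by rewrite ler_pM2r ?invr_gt0 // ler_nat.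
have t1_le1 : t1 <= 1 by rewrite ler_pdivrMr // mul1r ler_nat.
have hseg t : t0 <= t -> t <= t1 -> h t = r.+1%:R - k0%:R * t + (D r.+1)%:~R.
  rewrite ler_pdivrMr // ler_pdivlMr // ![t * _]mulrC => tt0 tt1.
  have ht : 0 <= t <= 1.
    apply/andP; split; first by rewrite -(pmulr_rge0 _ k0_gt0) (le_trans _ tt0) ?ler0n.
    by rewrite -(ler_pM2l k0_gt0) mulr1 (le_trans tt1) // ler_nat.
  have /andP[ht0 ht1] := ht.
  rewrite (pairc_path_segment reg_b i2 ht nq) ?o ?lenk0 //.
  apply: le_trans (_ : r%:R <= _).
    by rewrite ler_nat leqNgt diag_lenP ?ltnn //; lia.
  by apply: le_trans tt0 _; rewrite ler_wpM2r // ler_nat.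
have ht0 : h t0 = (D r.+1)%:~R + 1.
  by rewrite hseg // mulrC divfK ?gt_eqF // -natr1; ring.
have ht1 : h t1 = (D r.+1)%:~R.
  by rewrite hseg // mulrC divfK ?gt_eqF // subrr add0r.
exists (D r.+1)%:~R; split.
  split; first by exists t1; rewrite t1_le1 (le_trans t0_ge0).
  by move=> y [t [t01' <-]]; apply: path_ge.
right; split.
  rewrite -[-1]/((-1)%:~R) ler_int.
  by have := rfst 0%N isT; rewrite [X in _ < X]/sgn_sum big_geq //; lia.
exists t0, t1; split.
- split; first by rewrite t1_le1 (le_trans t0_ge0).
  move=> t [t01' /(path_eq_min rmin t01')[k [nk ok Dk kt]]].
  (* Together with [k <= k0] this yields [t = len k / k >= (r + 1) / k0]. *)
  have lk : (r < len k)%N.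
    by rewrite ltnNge; apply/negP => rl; have := rfst _ rl; rewrite Dk ltxx.
  have kk0 : (k <= k0)%N by rewrite -diag_lenP // (leq_trans lk) // diag_len_leq.
  have /andP[t_ge0 _] := t01'.
  rewrite ler_pdivrMr // mulrC (le_trans (_ : _ <= k%:R * t)) //.
    by rewrite kt ler_nat.
  by rewrite ler_wpM2r // ler_nat.
- split; first by rewrite t0_ge0.
  move=> t [/andP[_ tt1] ht]; rewrite leNgt; apply/negP => tt0.
  move: (tt0); rewrite ltr_pdivrMr //.
  by move: ht; rewrite hseg // ?ltW // -natr1; lra.
exists (lspath R (Psi b')); split=> // t t01'.
have Ek : (diag_end b' r).+1 = k0 by rewrite /k0 /diag_end bE eqxx; lia.
have := lspath_incr (R := R) reg_b' reg_b bE t01'; rewrite /= Ek.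
have -> : diag_len b' k0 = r.
  by have := diag_len_incr bE k0; rewrite lenk0 Ek eqxx; lia.
have -> : alpha R (diag_end b' r) = alpha R i.
  by apply: alpha_parity; move: o; rewrite -Ek addSn.
move/eqP; rewrite -subr_eq opprK eq_sym => /eqP ->.
case: (leP t t0) => tt0.
  move: (tt0); rewrite ler_pdivlMr // mulrC => tt.
  by rewrite !min_l ?subrr ?scale0r ?addr0 // (le_trans tt) // ler_nat.
have tt0' : r%:R <= k0%:R * t by rewrite mulrC -ler_pdivrMr // ltW.
rewrite (min_r tt0'); case: (leP t t1) => tt1.
  rewrite min_l; last by rewrite mulrC -ler_pdivlMr.
  rewrite /sref paircB ht0 hseg // ?ltW // addrA [_ + (_ - _)]addrC subrK.
  congr (_ + _); rewrite -scaleNr; congr (_ *: _); rewrite -natr1; ring.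
rewrite min_r; last by rewrite mulrC -ler_pdivrMr // ltW.
by rewrite -natr1 addrAC subrr add0r scale1r.
Qed.

End RootOperators.

(** * Weights and bijectivity *)

(** The range of rows no longer depends on [k], as the exchange of sums in [lspath_weight] requires;
    the test [r < k] discards rows below the lower end of the antidiagonal. *)
Lemma diag_len_rows b k : inY0 b ->
  diag_len b k = (\sum_(0 <= r < size b) ((r < k) && (k <= diag_end b r)))%N.
Proof.
move=> reg_b; pose F r : nat := (r < k)%N && (k <= diag_end b r)%N.
have -> : diag_len b k = (\sum_(0 <= r < k) F r)%N.
  rewrite /diag_len -sum1_count big_mkcond /index_iota subn0.
  by apply: eq_big_seq => r; rewrite mem_iota /F => /andP[_ ->] /=; case: leq.
have [kn|nk] := leqP k (size b).
  rewrite (big_cat_nat (leq0n k) kn) /= [X in (_ + X)%N]big_nat [X in (_ + X)%N]big1 ?addn0 // => r.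
  by rewrite /F => /andP[kr _]; rewrite ltnNge kr.
rewrite (big_cat_nat (leq0n _) (ltnW nk)) /=.
rewrite [X in (_ + X)%N]big_nat [X in (_ + X)%N]big1 ?addn0 // => r.
by rewrite /F => /andP[nr rk]; rewrite diag_end_out // [(k <= r)%N]leqNgt rk andbF.
Qed.

(** At [t = 1] the formula counts boxes by antidiagonals; exchanging the sums counts them by rows,
    as the weight does. *)
Lemma lspath_weight (R : realType) b : inY0 b -> lspath R (Psi b) 1 = pwt R 0 b.
Proof.
move=> reg_b; rewrite (@lspath_diag _ _ reg_b _ (head 0%N b).+1) ?ler01 ?lexx //.
rewrite scale1r /pwt -addrA -opprD; congr (_ - _).
set M := (head 0%N b).+1.
transitivity (\sum_(0 <= r < size b) \sum_(1 <= c < (nth 0%N b r).+1)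
    alpha R (c + r).-1); last first.
  rewrite /nboxes !natr_sum !scaler_suml -big_split /= big_mkord.
  apply: eq_bigr => r _; rewrite !natr_sum !scaler_suml -big_split /=.
  apply: eq_big_nat => -[//|c] _; rewrite /alpha addSn /= /label.
  have -> : (0 + r.+1 + c.+1 = c + r + 2)%N by lia.
  rewrite modnDr modn2; case: odd => /=.
    by rewrite scale0r scale1r add0r.
  by rewrite scale0r scale1r addr0.
rewrite (eq_big_nat _ _ (F2 := fun k => \sum_(0 <= r < size b)
    ((r < k) && (k <= diag_end b r))%N%:R *: alpha R k.-1)); last first.
  move=> k _; rewrite mulr1 min_r ?ler_nat ?diag_len_leq //.
  by rewrite diag_len_rows // natr_sum scaler_suml.
rewrite exchange_big_nat /=; apply: eq_big_nat => r /andP[_ rn].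
have qM : (diag_end b r < M)%N.
  have := diag_end_anti (r := 0) reg_b (s := r); rewrite (ltnW rn) /M => /(_ isT).
  by rewrite {2}/diag_end nth0 addn0.
have rq := diag_end_ge b r.
rewrite (@big_cat_nat _ _ _ r.+1 1%N M) //=; last by lia.
rewrite [X in X + _]big_nat big1 ?add0r; last first.
  by move=> k /andP[_ kr]; rewrite ltnNge -ltnS kr scale0r.
rewrite (@big_cat_nat _ _ _ (diag_end b r).+1 r.+1 M) //=.
rewrite [X in _ + X]big_nat [X in _ + X]big1 ?addr0; last first.
  by move=> k /andP[kr _]; rewrite andbC leqNgt kr scale0r.
rewrite -[r.+1]add1n big_addn (_ : _ - r = (nth 0 b r).+1)%N; last first.
  by rewrite /diag_end -addSn addnK.
apply: eq_big_nat => c /andP[c0 cr].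
have -> : (r < c + r <= diag_end b r)%N by rewrite /diag_end; lia.
by rewrite scale1r.
Qed.

(** If row [r] were longer in one partition, the antidiagonal on which it ends there would have more
    than [r] boxes in that partition only. *)
Lemma diag_len_inj b b' : inY0 b -> inY0 b' -> size b = size b' ->
  diag_len b =1 diag_len b' -> b = b'.
Proof.
move=> reg_b reg_b' Es El; apply: (eq_from_nth (x0 := 0%N)) => // r _.
have le c c' : inY0 c -> inY0 c' -> diag_len c =1 diag_len c' ->
    (nth 0 c r <= nth 0 c' r)%N.
  move=> rc rc' Ec; rewrite leqNgt; apply/negP => lt.
  have rq : (r < diag_end c r)%N by rewrite /diag_end; lia.
  have := diag_lenP rc rq; rewrite leqnn Ec diag_lenP // /diag_end; lia.
by apply/eqP; rewrite eqn_leq !le // => k; rewrite El.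
Qed.

(** The directions determine [n] and [m], the break points give the lengths for [n < k <= m], and
    the other lengths are forced. *)
Lemma Psi_inj : {in inY0 &, injective Psi}.
Proof.
move=> b b' reg_b reg_b'; rewrite !PsiE // => -[/(can_inj revK) Es Ea].
have [En Em] : size b = size b' /\ head 0%N b = head 0%N b'.
  have nm := size_le_head reg_b; have nm' := size_le_head reg_b'.
  have := congr1 (head 0%N) Es => /= En.
  have := congr1 size Es; rewrite /= !size_iota => Em.
  by split=> //; lia.
apply: diag_len_inj => // k.
have [kn|nk] := leqP k (size b); first by rewrite !diag_len_full // -?En.
have [km|mk] := leqP k (head 0%N b); last by rewrite !diag_len0 // -?Em.
have kin : k \in rev (iota (size b).+1 (head 0 b - size b))%N.
  by rewrite mem_rev mem_iota; lia.
move: Ea; rewrite -En -Em => /eq_in_map/(_ k kin)/mulIf E.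
apply/eqP; rewrite -(eqr_nat rat); apply/eqP/E.
by rewrite invr_eq0 pnatr_eq0; lia.
Qed.

(** * The integrality condition on LS paths *)

Definition simple_root (k : nat) : bool * nat := (odd k, (~~ odd k : nat)).

Lemma rootv_simple (F : fieldType) k : rootv F (simple_root k) = alpha F k.
Proof.
rewrite /rootv /alpha /delta /=; case: odd => /=; first by rewrite scale0r addr0.
by rewrite scale1r addrCA addNr addr0.
Qed.

Lemma pairr_simple (F : fieldType) (v : wt F) k :
  pairr v (simple_root k) = pairc v k.
Proof. by rewrite /pairr /pairc /=; case: odd => /=; ring. Qed.

(** The hypothesis amounts to [p * beta = k.+1 * alpha_k] for the pairing [p]. The only positive
    real root proportional to [alpha_k] is [alpha_k] itself, so the existential in [achain] leaves
    no choice. *)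
Lemma root_step_unique k beta : posroot beta ->
    rref beta (wLam rat k) = wLam rat k.+1 ->
  pairr (wLam rat k) beta = k.+1%:R.
Proof.
case: beta => s l; rewrite wLamS /rref; move: (pairr _ _) => p pos.
move/addrI/oppr_inj => E.
have := congr1 (fun v => wcoord v 1) E; have := congr1 (fun v => wcoord v 2) E.
have k0 : 0 < k.+1%:R :> rat by rewrite ltr0n.
have l0 : 0 <= l%:R :> rat by rewrite ler0n.
rewrite /rootv /delta /alpha0 /alpha1 /wcoord !mxE !inordK //= {E}.
have -> : alpha rat k ord0 (inord 2) = (odd k)%:R.
  by rewrite /alpha; case: odd; rewrite mxE inordK.
have -> : alpha rat k ord0 (inord 1) = (~~ odd k)%:R.
  by rewrite /alpha; case: odd; rewrite mxE inordK.
case: s pos => /= pos; rewrite !mxE ?inordK //=.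
  case: odd => /= E2 E1; last by nra.
  have : p * l%:R = 0 by lra.
  by move/eqP; rewrite mulf_eq0 => /orP[/eqP p0|/eqP lz]; [nra|rewrite lz in E2; lra].
case: odd => /= E2 E1.
  have : p * l%:R = 0 by lra.
  move/eqP; rewrite mulf_eq0 pnatr_eq0 => /orP[/eqP p0|/eqP lz]; last by rewrite lz in pos.
  by rewrite p0 in E2; lra.
have : p * (l%:R - 1) = 0 by lra.
move/eqP; rewrite mulf_eq0 => /orP[/eqP p0|/eqP lz]; first by rewrite p0 in E1; lra.
have l1 : l%:R = 1 :> rat by lra.
by rewrite l1 in E1; lra.
Qed.

Lemma achain_int a p q k : achain a p q -> (q < k <= p)%N ->
  a * k%:R \is a Num.int.
Proof.
case: k => [|k]; first by rewrite ltn0.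
by move=> ch /ch[beta [pos /(root_step_unique pos) /= ->]].
Qed.

Lemma achainS (a : rat) k : a * k.+1%:R \is a Num.int -> achain a k.+1 k.
Proof.
move=> ak j jk; have -> : j = k.+1 by lia.
exists (simple_root k); rewrite -[k.+1.-1]/k; split.
- by rewrite /posroot /=; case: odd.
- by rewrite wLamS /rref rootv_simple pairr_simple pairc_wLam addnn odd_double.
by rewrite pairr_simple pairc_wLam addnn odd_double.
Qed.

(** Consecutive directions differ by one step, so integrality only concerns the product of
    [len k / k] and [k]. *)
Lemma Psi_LS b : inY0 b -> is_LS (Psi b).
Proof.
move=> reg_b; have nm := size_le_head reg_b.
have ss : size (lsig (Psi b)) = (head 0 b - size b).+1%N.
  by rewrite size_rev size_iota.
split.
- by rewrite ss.
- by rewrite rev_sorted; apply: iota_ltn_sorted.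
- by rewrite ss size_map size_rev size_iota.
- rewrite Psi_breaks //; apply/(sortedP 0) => j; rewrite size_map size_rev size_iota => jL.
  rewrite !(nth_map 0%N) ?size_rev ?size_iota //; last exact: ltnW.
  rewrite !nth_rev ?size_iota //; last exact: ltnW.
  rewrite !nth_iota; [|lia..].
  have -> : (size b + ((head 0 b - size b).+2 - j.+1)
    = (size b + ((head 0 b - size b).+2 - j.+2)).+1)%N by lia.
  by apply: brk_lt => //; lia.
rewrite ss -pred_Sn => j jL.
have -> : nth 0%N (lsig (Psi b)) j = (head 0 b - j.+1).+1%N.
  by rewrite nth_rev ?size_iota ?nth_iota; lia.
have -> : nth 0%N (lsig (Psi b)) j.+1 = (head 0 b - j.+1)%N.
  by rewrite nth_rev ?size_iota ?nth_iota; lia.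
apply: achainS; rewrite PsiE // (nth_map 0%N) ?size_rev ?size_iota //.
rewrite nth_rev ?size_iota // nth_iota; last by lia.
have -> : ((size b).+1 + (head 0 b - size b - j.+1) = (head 0 b - j.+1).+1)%N by lia.
by rewrite divfK ?pnatr_eq0 // natr_int.
Qed.

(** * Reconstruction of a partition from its antidiagonals *)

Section FromDiagonals.
Variables (n L : nat) (I : nat -> nat).
Hypothesis I_anti : forall x y, (n < x <= y)%N -> (y <= n + L)%N -> (I y <= I x)%N.
Hypothesis I_pos : forall k, (n < k <= n + L)%N -> (0 < I k)%N.
Hypothesis I_le : forall k, (n < k <= n + L)%N -> (I k <= n)%N.

(** Row [r] receives its staircase part [n - r] and one box for each later antidiagonal of
    prescribed length above [r]. *)
Definition of_diagonals : seq nat :=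
  [seq (n - r + count (fun k => r < I k) (iota n.+1 L))%N | r <- iota 0 n].
Local Notation b := of_diagonals.

Lemma size_of_diagonals : size b = n.
Proof. by rewrite size_map size_iota. Qed.

Lemma nth_of_diagonals r : (r < n)%N ->
  nth 0%N b r = (n - r + count (fun k => r < I k) (iota n.+1 L))%N.
Proof. by move=> rn; rewrite (nth_map 0%N) ?size_iota // nth_iota. Qed.

Lemma regular_of_diagonals : inY0 b.
Proof.
apply: regularI => r; rewrite size_of_diagonals => rn.
rewrite (nth_of_diagonals rn); have [r1n|nr1] := ltnP r.+1 n; last first.
  by rewrite nth_default ?size_of_diagonals //; lia.
rewrite nth_of_diagonals //.
have : (count (fun k => r.+1 < I k) (iota n.+1 L)
        <= count (fun k => r < I k) (iota n.+1 L))%N.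
  by apply: sub_count => k /ltnW.
lia.
Qed.

Lemma diag_len_of_diagonals k : (n < k <= n + L)%N -> diag_len b k = I k.
Proof.
move=> kL; have /andP[nk kL'] := kL.
have lenE r : (r < n)%N -> (r < diag_len b k)%N = (r < I k)%N.
  move=> rn; rewrite diag_lenP ?regular_of_diagonals //; last by lia.
  rewrite /diag_end nth_of_diagonals // -[n.+1]addn0 iotaDl count_map.
  (* As [I] is nonincreasing, the antidiagonals meeting row [r] beyond the staircase are consecutive
     from [n.+1], and their number tells where the row ends. *)
  have := @count_iota_down (preim (addn n.+1) (fun k => r < I k)%N) L (k - n.+1)%N.
  rewrite /= subnKC // => <-; first by lia.
    by move=> s s' ss' /= h; apply: leq_trans h _; apply: I_anti; lia.
  lia.
have := I_le kL.
have := diag_len_size regular_of_diagonals (k := k); rewrite size_of_diagonals.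
move=> /(_ (ltnW nk)) l1 l2; apply/eqP; case: ltngtP => // lt.
  by have := lenE _ (leq_trans lt l2); rewrite ltnn lt.
by have := lenE _ (leq_trans lt l1); rewrite ltnn lt.
Qed.

Lemma head_of_diagonals : head 0%N b = (n + L)%N.
Proof.
have [n0|n0] := posnP n.
  (* For [n = 0], a positive [L] would give [0 < I 1 <= 0]. *)
  suff L0 : L = 0%N by rewrite -nth0 nth_default ?size_of_diagonals ?L0; lia.
  by have := @I_pos n.+1; have := @I_le n.+1; lia.
rewrite -nth0 nth_of_diagonals // subn0; congr addn.
rewrite -[RHS](size_iota n.+1); apply/eqP; rewrite -all_count; apply/allP => k.
by rewrite mem_iota => kL; apply: I_pos; lia.
Qed.

End FromDiagonals.

(** Integrality forces the directions to drop by exactly one. The products of the break points with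
    their indices [k] are then integers that satisfy the conditions for antidiagonal lengths. *)
Lemma Psi_surj d : is_LS d -> exists2 b, inY0 b & Psi b = d.
Proof.
case: d => s a [/= s0 s_sort a_size a_sort ch].
pose L := (size s).-1; pose n := nth 0%N s L.
have a01 j : (j < L)%N -> 0 < nth 0 a j < 1.
  move=> jL; have sz : size (0 :: a ++ [:: 1 : rat]) = L.+2.
    by rewrite /= size_cat a_size addn1.
  have lt x y : (x < y < L.+2)%N -> nth 0 (0 :: a ++ [:: 1]) x < nth 0 (0 :: a ++ [:: 1]) y.
    move=> /andP[xy yL]; apply: (sorted_ltn_nth lt_trans) => //; rewrite inE sz //.
    exact: ltn_trans yL.
  have := lt 0%N j.+1 ltac:(lia); have := lt j.+1 L.+1 ltac:(lia).
  by rewrite /= !nth_cat a_size -/L jL ltnn subnn /= => -> ->.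
have a_lt j : (j.+1 < L)%N -> nth 0 a j < nth 0 a j.+1.
  move=> jL; have /(pathP 0) lt := a_sort; have := lt j.+1.
  rewrite /= size_cat a_size -/L addn1 !nth_cat a_size -/L jL (ltnW jL).
  by apply; lia.
have s_step j : (j < L)%N -> nth 0%N s j = (nth 0%N s j.+1).+1.
  move=> jL; have /(sortedP 0%N) srt := s_sort.
  have lt : (nth 0 s j.+1 < nth 0 s j)%N by apply: srt; rewrite /L in jL; lia.
  apply/eqP; rewrite eqn_leq lt andbT leqNgt; apply/negP => gap.
  have c := ch j jL; set p := nth 0%N s j in lt gap c.
  (* A gap makes two consecutive multiples of the break point integral, hence also their difference,
     which lies strictly between 0 and 1. *)
  have ip : nth 0 a j * p%:R \is a Num.int by apply: achain_int c _; lia.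
  have ip1 : nth 0 a j * p.-1%:R \is a Num.int by apply: achain_int c _; lia.
  have : nth 0 a j \is a Num.int.
    have -> : nth 0 a j = nth 0 a j * p%:R - nth 0 a j * p.-1%:R.
      by rewrite -[in p%:R](@prednK p) -?natr1; [ring|lia].
    exact: rpredB.
  have /andP[h0 h1] := a01 j jL.
  by move=> /intrP[z Ez]; move: h0 h1; rewrite Ez ltr0z ltrz1; lia.
have s_nth j : (j <= L)%N -> nth 0%N s j = (n + (L - j))%N.
  move=> jL; have [e] := ubnP (L - j)%N; elim: e => // e IHe in j jL *.
  move: jL; rewrite leq_eqVlt => /predU1P[-> _|jL le]; first by rewrite subnn addn0.
  by rewrite s_step // IHe; lia.
(* The break point belonging to [k] has index [n + L - k]. Truncation only casts the product to
   [nat], as [IE] shows. *)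
pose I k := Num.truncn (nth 0 a (n + L - k)%N * k%:R).
have IE k : (n < k <= n + L)%N -> (I k)%:R = nth 0 a (n + L - k)%N * k%:R.
  move=> kL; rewrite truncnK // natrEint; apply/andP; split.
    have jL : (n + L - k < L)%N by lia.
    by apply: achain_int (ch _ jL) _; rewrite !s_nth; lia.
  have /andP[h0 _] := a01 (n + L - k)%N ltac:(lia).
  by rewrite mulr_ge0 ?ler0n // ltW.
have I_pos k : (n < k <= n + L)%N -> (0 < I k)%N.
  move=> kL; have /andP[h0 _] := a01 (n + L - k)%N ltac:(lia).
  by rewrite -(ltr0n rat) IE // mulr_gt0 // ltr0n; lia.
have I_lt k : (n < k <= n + L)%N -> (I k < k)%N.
  move=> kL; have /andP[_ h1] := a01 (n + L - k)%N ltac:(lia).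
  by rewrite -(ltr_nat rat) IE // gtr_pMl // ltr0n; lia.
have I_step k : (n < k < n + L)%N -> (I k.+1 <= I k)%N.
  move=> kL; have E1 := IE k ltac:(lia); have E2 := IE k.+1 ltac:(lia).
  have := a_lt (n + L - k.+1)%N ltac:(lia).
  have -> : ((n + L - k.+1).+1 = n + L - k)%N by lia.
  have lt := I_lt k ltac:(lia) => al.
  (* This is the strict order of two break points; together with [I k < k] it excludes
     [I k < I k.+1]. *)
  have : (I k.+1 * k < I k * k.+1)%N.
    rewrite -(ltr_nat rat) !natrM E1 E2 -!mulrA [k%:R * _]mulrC.
    by rewrite ltr_pM2r // -natrM ltr0n; lia.
  nia.
have I_anti x y : (n < x <= y)%N -> (y <= n + L)%N -> (I y <= I x)%N.
  move=> /andP[nx]; elim: y => [|y IHy]; first by lia.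
  rewrite leq_eqVlt => /predU1P[-> //|]; rewrite ltnS => xy yL.
  by apply: leq_trans (IHy xy (ltnW yL)); apply: I_step; lia.
have I_le k : (n < k <= n + L)%N -> (I k <= n)%N.
  move=> kL; have := I_anti n.+1 k ltac:(lia) ltac:(lia).
  by have := I_lt n.+1 ltac:(lia); lia.
have reg := regular_of_diagonals n L I.
exists (of_diagonals n L I) => //.
rewrite PsiE // size_of_diagonals (head_of_diagonals I_pos I_le) addKn.
congr LSD.
  apply: (eq_from_nth (x0 := 0%N)); rewrite size_rev size_iota; first by rewrite /L prednK.
  move=> j jL; rewrite s_nth // nth_rev ?size_iota // nth_iota; last by lia.
  by congr addn; lia.
apply: (eq_from_nth (x0 := 0)); rewrite size_map size_rev size_iota ?a_size // => j jL.
rewrite (nth_map 0%N) ?size_rev ?size_iota // nth_rev ?size_iota // nth_iota; last by lia.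
set k := (n.+1 + _)%N; have kL : (n < k <= n + L)%N by rewrite /k; lia.
rewrite diag_len_of_diagonals // IE // mulfK ?pnatr_eq0; last by lia.
by congr nth; rewrite /k; lia.
Qed.

Theorem mainTheorem1 (R : realType) :
  [/\ (* Psi maps Y(0) into P_{Lambda_0} ... *)
      (forall b, inY0 b -> is_LS (Psi b)),
      (* ... injectively ... *)
      {in inY0 &, injective Psi},
      (* ... and onto *)
      (forall d, is_LS d -> exists2 b, inY0 b & Psi b = d),
      (* weights are preserved (weight of an LS path = its endpoint) *)
      (forall b, inY0 b -> lspath R (Psi b) 1 = pwt R 0 b) &
      (* commutation with the root operators (Psi(0) = 0) *)
      (forall b (i : 'I_2), inY0 b ->
        [/\ (if cf 0 i b is Some b' then inY0 b' else True),
            (if ce 0 i b is Some b' then inY0 b' else True),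
            Lf i (lspath R (Psi b)) (omap (fun b' => lspath R (Psi b')) (cf 0 i b)) &
            Le i (lspath R (Psi b)) (omap (fun b' => lspath R (Psi b')) (ce 0 i b))])].
Proof.
split.
- exact: Psi_LS.
- exact: Psi_inj.
- exact: Psi_surj.
- exact: lspath_weight.
move=> b i reg_b.
have [? ?] := Lf_Psi R reg_b (ltn_ord i).
by have [? ?] := Le_Psi R reg_b (ltn_ord i).
Qed.
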